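(* There is an orthogonal decomposition of $F(2^{\mathbb{Z}^2})$, given by a sequence of partitions $\{\mathcal{R}_k\}_{k\ge1}$, in which for every $k\ge1$ all $k$-atoms are homeomorphic to disks.
   Context: $\mathbb{Z}^2$ acts on $2^{\mathbb{Z}^2}$ by $(g\cdot x)(h)=x(g+h)$, and $X=F(2^{\mathbb{Z}^2})=\{x:\forall g\in\mathbb{Z}^2\setminus\{0\},\ g\cdot x\ne x\}$. Its Schreier graph has edges $(x,s\cdot x)$, $s\in\{\pm e_1,\pm e_2\}$; connectedness refers to this graph and $\rho$ is the distance on orbits ($\infty$ between different orbits). Orthogonal decomposition: a sequence $\{\mathcal{R}_k\}_{k\ge1}$ of Borel partitions of $X$ into finite subsets of orbits (called regions) such that, with $\partial R=\{x\in R:\ s\cdot x\notin R\text{ for some standard generator }s\}$, $X_k=\bigcup\{\partial R:R\in\mathcal{R}_k\}$ and $X_k^\infty=\bigcup_{m\ge k}X_m$, the following hold for some constants $K>1$, $\epsilon>0$ and some marker distances $d_1<d_2<\cdots$ with $d_{k+1}>Kd_k$ for all $k$: (1) $\bigcap_kX_k^\infty=\varnothing$, and for each $k$ the connected components of $X\setminus X_k^\infty$ are finite; (2) (strong orthogonality) there is a function $\delta:X\times\mathbb{N}\times\mathbb{N}\to\{0,1\}$ such that $\delta(x,k,\ell)=0$ unless $x\in X_k^\infty$ and $\ell\le k$, and such that if $k<k'$, $x\in X_k$, $x'\in X_{k'}$, $\ell\le k$ and $\delta(x,k,\ell)=\delta(x',k',\ell)$, then $\rho(x,x')>\epsilon d_\ell$.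 For each $k$, the $k$-atoms are the elements of the coarsest common refinement of the partitions $\mathcal{R}_m$, $m\ge k$. A finite subset $A$ of an orbit $[y]$ is regarded as a subset of $\mathbb{R}^2$ in the obvious way: identify $[y]$ with $\mathbb{Z}^2$ via $g\cdot y\leftrightarrow g$ and replace $A$ by the union of the closed unit squares $g+[0,1]^2$ for $g\cdot y\in A$; ''homeomorphic to a disk'' means that this union is homeomorphic to the closed unit disk of $\mathbb{R}^2$. *)

(* Defs.v *)
From mathcomp Require Import all_boot all_order all_algebra.
From mathcomp Require Import all_classical all_reals all_analysis.

Set Implicit Arguments.
Unset Strict Implicit.
Unset Printing Implicit Defensive.

Import Order.TTheory GRing.Theory Num.Theory.
Import numFieldNormedType.Exports.

Local Open Scope classical_set_scope.
Local Open Scope ring_scope.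

Notation Z2 := (int * int)%type.

(* 2^(Z^2) with the product topology *)
Notation shift_space := (prod_topology (fun _ : Z2 => bool)).

Definition zact (g : Z2) (x : shift_space) : shift_space := fun h => x (g + h).

Definition free_part : set shift_space :=
  [set x | forall g : Z2, g != 0 -> zact g x <> x].

Definition orbit_of (y : shift_space) : set shift_space :=
  [set zact g y | g in [set: Z2]].

Definition std_gens : seq Z2 := [:: (1, 0); (-1, 0); (0, 1); (0, -1)].

Definition schreier : rel shift_space :=
  fun x y => `[< exists2 s, s \in std_gens & y = zact s x >].

(* graph distance; ereal_inf set0 = +oo, so it is +oo between distinct orbits *)
Definition rho (R : realType) (x y : shift_space) : \bar R :=
  ereal_inf [set (size p)%:R%:E
            | p in [set p | path schreier x p /\ last x p = y]].

(* connected component of x in the subgraph of the Schreier graph induced on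
   S, for x in S *)
Definition component (S : set shift_space) (x : shift_space) :
    set shift_space :=
  [set y | exists p, [/\ path schreier x p, last x p = y
                       & {in x :: p, forall z, S z}]].

Definition borel (T : topologicalType) (A : set T) : Prop :=
  <<s (@open T) >> A.

Definition same_piece (T : Type) (P : set (set T)) (x y : T) : Prop :=
  exists2 A, P A & A x /\ A y.

(* A partition is Borel when its equivalence relation is a Borel set of pairs;
   since free_part is Borel in shift_space, being Borel in
   free_part * free_part or in shift_space * shift_space is the same. *)
Definition borel_region_partition (P : set (set shift_space)) : Prop :=
  [/\ partition P id free_part,
      forall A, P A -> finite_set A /\ exists2 y, free_part y & A `<=` orbit_of y
    & @borel (shift_space * shift_space)%type
        [set p | same_piece P p.1 p.2]].

Definition boundary (A : set shift_space) : set shift_space :=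
  [set x | A x /\ exists2 s, s \in std_gens & ~ A (zact s x)].

(* Sequences are indexed by k >= 1: the terms of index 0 are never used. *)
Section Decomposition.
Variable P : nat -> set (set shift_space).

Definition bdry (k : nat) : set shift_space :=
  \bigcup_(A in P k) boundary A.

Definition bdry_from (k : nat) : set shift_space :=
  \bigcup_(m in [set m | (k <= m)%N]) bdry m.

Definition strongly_orthogonal (R : realType) (eps : R) (d : nat -> nat) :
    Prop :=
  exists delta : shift_space -> nat -> nat -> bool,
    (forall x k l, free_part x -> (1 <= k)%N -> (1 <= l)%N ->
       ~ (bdry_from k x /\ (l <= k)%N) -> delta x k l = false) /\
    (forall x x' k k' l, (1 <= k)%N -> (1 <= l)%N ->
       (k < k')%N -> bdry k x -> bdry k' x' -> (l <= k)%N ->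
       delta x k l = delta x' k' l ->
       ((eps * (d l)%:R)%:E < rho R x x')%E).

Definition orthogonal_decomposition (R : realType) : Prop :=
  (forall k, (1 <= k)%N -> borel_region_partition (P k)) /\
  exists (K eps : R) (d : nat -> nat),
    [/\ 1 < K /\ 0 < eps,
        forall k, (1 <= k)%N ->
          [/\ (0 < d k)%N, (d k < d k.+1)%N & K * (d k)%:R < (d k.+1)%:R],
        \bigcap_(k in [set k | (1 <= k)%N]) bdry_from k = set0,
        forall k, (1 <= k)%N -> forall x, (free_part `\` bdry_from k) x ->
          finite_set (component (free_part `\` bdry_from k) x)
      & strongly_orthogonal eps d].

(* The pieces of the coarsest common refinement of the P m, m >= k, are the
   nonempty intersections of a choice of one region in each P m. *)
Definition atoms (k : nat) : set (set shift_space) :=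
  [set A | A !=set0 /\
     exists2 B : nat -> set shift_space,
       (forall m, (k <= m)%N -> P m (B m))
     & A = \bigcap_(m in [set m | (k <= m)%N]) B m].

End Decomposition.

Definition homeomorphic (T U : topologicalType) (A : set T) (B : set U) :
    Prop :=
  exists (f : T -> U) (g : U -> T),
    [/\ {within A, continuous f}, {within B, continuous g},
        f @` A = B & {in A, cancel f g}].

Section Planar.
Variable R : realType.

Definition unit_disk : set (R * R) :=
  [set p | p.1 ^+ 2 + p.2 ^+ 2 <= 1].

Definition unit_square (g : Z2) : set (R * R) :=
  [set p | (g.1%:~R <= p.1 <= g.1%:~R + 1) /\
           (g.2%:~R <= p.2 <= g.2%:~R + 1)].

(* union of the unit squares of A, the orbit of y being identified with Z^2
   through g |-> zact g y *)
Definition realization (y : shift_space) (A : set shift_space) :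
    set (R * R) :=
  \bigcup_(g in [set g | A (zact g y)]) unit_square g.

(* Changing the base point y within the orbit only translates the
   realization. *)
Definition homeomorphic_to_disk (A : set shift_space) : Prop :=
  exists y, [/\ free_part y, A `<=` orbit_of y
              & homeomorphic (realization y A) unit_disk].

End Planar.

(* Main.v *)
Require Import Defs.
From mathcomp Require Import all_boot all_order all_algebra.
From mathcomp Require Import all_classical all_reals all_analysis.
From mathcomp Require Import zify ring lra.

(* In an orbit, identified with Z^2, we build a laminar family of finite "pieces"
   of levels 0, 1, 2, ... with pairwise well separated boundaries, such that every
   point lies in pieces of arbitrarily high level.  For each level the Borel
   marker points are spread so thin that the balls around them are far apart;
   finitely many translates of a maximal discrete set cover everything, and by
   the pigeonhole principle one translate (chosen orbit by orbit) covers each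
   point at infinitely many levels.  A ball of level n is turned into a piece by
   absorbing, for m = n-1, ..., 0, all the balls of level m that it nearly
   touches, and taking each time the convex hull for the order
   (x, y) <= (x', y') iff |x' - x| <= 2^m (y' - y).
   Widening the cone from one level to the next keeps the changes local, and
   connected order-convex sets of cells are discs because they are made of
   consecutive overlapping columns.

   The partition of level j consists, inside a piece of level j, of the maximal
   pieces of lower level and of singletons; elsewhere a region is a (slightly
   smaller copy of a) piece of level n > j minus the ones of level < n inside.
   Near a boundary point of level j of the second kind, the only other partition
   which cuts is that of level n; near the boundary of a piece of level m lying
   maximally in a piece of level n, only the levels m and n cut.  So three levels
   never meet, which gives the orthogonality, and every k-atom is a singleton or
   a piece of level less than k. *)

Set Implicit Arguments.
Unset Strict Implicit.
Unset Printing Implicit Defensive.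

Import Order.TTheory GRing.Theory Num.Theory.
Import numFieldNormedType.Exports.

Local Open Scope classical_set_scope.
Local Open Scope ring_scope.

(** * Gluing rectangles to discs *)

Lemma within_continuous_comp (T U V : topologicalType) (A : set T) (B : set U)
    (f : T -> U) (g : U -> V) : (forall x, A x -> B (f x)) ->
  {within A, continuous f} -> {within B, continuous g} -> {within A, continuous (g \o f)}.
Proof.
move=> fB /subspace_continuousP cf /subspace_continuousP cg.
apply/subspace_continuousP => x Ax S gS.
have h : nbhs x [set y | A y -> B (f y) -> S (g (f y))] := cf _ Ax _ (cg _ (fB _ Ax) _ gS).
suff : nbhs x [set y | A y -> S (g (f y))] by [].
by apply: filterS h => y /= h Ay; apply: h => //; apply: fB.
Qed.

Lemma homeomorphic_trans (T U V : topologicalType) (A : set T) (B : set U) (C : set V) :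
  homeomorphic A B -> homeomorphic B C -> homeomorphic A C.
Proof.
move=> [f [g [cf cg fAB fK]]] [f' [g' [cf' cg' fBC f'K]]].
have fB x : A x -> B (f x) by move=> Ax; rewrite -fAB; exists x.
have gB y : C y -> B (g' y).
  by rewrite -fBC => -[x Bx <-]; rewrite f'K ?inE.
exists (f' \o f), (g \o g'); split.
- exact: within_continuous_comp cf cf'.
- exact: within_continuous_comp cg' cg.
- by rewrite -image_comp fAB.
by move=> x /[!inE] Ax /=; rewrite f'K ?inE ?fK ?inE//; apply: fB.
Qed.

Lemma continuous_within_eq (T U : topologicalType) (A : set T) (f g : T -> U) :
  (forall x, A x -> g x = f x) -> continuous f -> {within A, continuous g}.
Proof.
move=> e cf; have cAf : {within A, continuous f} by exact: continuous_subspaceT.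
by apply: subspace_eq_continuous cAf => x /[!inE] /e.
Qed.

(** Pasting of two closed pieces: the map is the identity on [D] and [f] on [K1]. The last
    hypothesis makes the two rules agree on the overlap, for the map and for its inverse. *)
Lemma homeomorphic_glue (T : topologicalType) (D K1 K2 : set T) (f g : T -> T) :
  closed D -> closed K1 -> closed K2 -> continuous f -> continuous g ->
  cancel f g -> cancel g f -> f @` K1 = K2 ->
  (forall z, D z -> K1 z \/ K2 z -> [/\ K1 z, K2 z & f z = z]) ->
  homeomorphic (D `|` K1) (D `|` K2).
Proof.
move=> cD cK1 cK2 cf cg fK gK fK12 Dfix.
pose F z := if `[< D z >] then z else f z.
pose G z := if `[< D z >] then z else g z.
have FD z : D z -> F z = z by rewrite /F; case: asboolP.
have GD z : D z -> G z = z by rewrite /G; case: asboolP.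
have FK1 z : K1 z -> F z = f z.
  move=> K1z; rewrite /F; case: asboolP => // Dz.
  by have [_ _ fz] := Dfix z Dz (or_introl K1z); rewrite fz.
have GK2 z : K2 z -> G z = g z.
  move=> K2z; rewrite /G; case: asboolP => // Dz.
  by have [_ _ fz] := Dfix z Dz (or_intror K2z); rewrite -{2}fz fK.
have gK2 z : K2 z -> K1 (g z) by rewrite -fK12 => -[x K1x <-]; rewrite fK.
exists F, G; split.
- apply: withinU_continuous => //; last exact: continuous_within_eq cf.
  by apply: (@continuous_within_eq _ _ _ id) FD _ => z; exact: cvg_id.
- apply: withinU_continuous => //; last exact: continuous_within_eq cg.
  by apply: (@continuous_within_eq _ _ _ id) GD _ => z; exact: cvg_id.
- apply/seteqP; split=> z.
    move=> [x [Dx|K1x] <-]; first by rewrite FD //; left.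
    by rewrite FK1 // -fK12; right; exists x.
  move=> [Dz|K2z]; first by exists z; [left|exact: FD].
  by exists (g z); [right; exact: gK2|rewrite FK1 ?gK //; exact: gK2].
move=> z /[!inE] -[Dz|K1z]; first by rewrite FD // GD.
by rewrite FK1 // GK2 ?fK // -fK12; exists z.
Qed.

Section Plane.
Variable R : realType.
Implicit Types (w z o : R * R) (N : R * R -> R).

Lemma continuous_pair (T : topologicalType) (f g : T -> R) :
  continuous f -> continuous g -> continuous (fun x => (f x, g x)).
Proof. by move=> cf cg x; exact: cvg_pair (cf x) (cg x). Qed.

Lemma continuous_fst : continuous (fun z : R * R => z.1).
Proof. by move=> z; exact: cvg_fst. Qed.

Lemma continuous_snd : continuous (fun z : R * R => z.2).
Proof. by move=> z; exact: cvg_snd. Qed.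

(** * Gauges and radial homeomorphisms *)

Definition size1 w : R := `|w.1| + `|w.2|.

(** Minkowski functionals of star-shaped neighbourhoods of 0, possibly asymmetric, since rectangles
    will be viewed from points off their centres. *)
Definition is_gauge N : Prop :=
  [/\ continuous N,
      forall (t : R) w, 0 <= t -> N (t * w.1, t * w.2) = t * N w &
      exists m M : R, [/\ 0 < m, forall w, m * size1 w <= N w &
        forall w, N w <= M * size1 w]].

(** Radial rescaling: rays from 0 are preserved, and [N2] of the image equals [N1 w]. At [w = 0] the
    image is 0 whatever the quotient. *)
Definition regauge N1 N2 w : R * R := (N1 w / N2 w * w.1, N1 w / N2 w * w.2).

Lemma gauge_gt0 N w : is_gauge N -> w != 0 -> 0 < N w.
Proof.
move=> [_ _ [m [M [m0 mN _]]]] w0; apply: lt_le_trans (mN w).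
rewrite mulr_gt0 // /size1 lt_neqAle addr_ge0 // andbT eq_sym paddr_eq0 //.
by rewrite !normr_eq0; case: w w0 {mN} => a b; rewrite /= xpair_eqE.
Qed.

Lemma gauge0 N : is_gauge N -> N 0 = 0.
Proof.
by move=> [_ /(_ 0 0 (lexx _))]; rewrite /= !mul0r.
Qed.

Lemma regaugeK N1 N2 : is_gauge N1 -> is_gauge N2 ->
  cancel (regauge N1 N2) (regauge N2 N1).
Proof.
move=> g1 g2 w; have [->|w0] := eqVneq w 0.
  by rewrite /regauge /= !mulr0.
have n1 := gauge_gt0 g1 w0; have n2 := gauge_gt0 g2 w0.
have q0 : 0 <= N1 w / N2 w by rewrite divr_ge0 // ltW.
have [_ h1 _] := g1; have [_ h2 _] := g2.
rewrite /regauge h1 // h2 //=; have := lt0r_neq0 n1; have := lt0r_neq0 n2.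
move: (N1 w) (N2 w) => a b b0 a0; case: w {w0 n1 n2 q0} => x y /=.
by congr pair; field; rewrite b0.
Qed.

Lemma gauge_regauge N1 N2 w : is_gauge N1 -> is_gauge N2 ->
  N2 (regauge N1 N2 w) = N1 w.
Proof.
move=> g1 g2; have [->|w0] := eqVneq w 0.
  by rewrite /regauge /= !mulr0 !gauge0.
have n1 := gauge_gt0 g1 w0; have n2 := gauge_gt0 g2 w0.
have q0 : 0 <= N1 w / N2 w by rewrite divr_ge0 // ltW.
by have [_ h2 _] := g2; rewrite /regauge h2 // divfK // lt0r_neq0.
Qed.

Lemma regauge_id N1 N2 w : is_gauge N1 -> is_gauge N2 -> N1 w = N2 w ->
  regauge N1 N2 w = w.
Proof.
move=> g1 g2 e; have [->|w0] := eqVneq w 0; first by rewrite /regauge /= !mulr0.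
have n2 := gauge_gt0 g2 w0.
by rewrite /regauge e divff ?lt0r_neq0 // !mul1r -surjective_pairing.
Qed.

(** Away from 0 the formula is built from continuous functions with a nonzero denominator. At 0 the
    factor [N1 / N2] is bounded by [M1 / m2] while the coordinates tend to 0. *)
Lemma regauge_continuous N1 N2 : is_gauge N1 -> is_gauge N2 ->
  continuous (regauge N1 N2).
Proof.
move=> g1 g2.
have [c1 _ [m1 [M1 [m10 l1 u1]]]] := g1; have [c2 _ [m2 [M2 [m20 l2 u2]]]] := g2.
suff comp (f : R * R -> R) : continuous f -> (forall v, `|f v| <= size1 v) ->
    continuous (fun v => N1 v / N2 v * f v).
  apply: continuous_pair; apply: comp.
  - exact: continuous_fst.
  - by move=> v; rewrite lerDl.
  - exact: continuous_snd.
  - by move=> v; rewrite lerDr.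
move=> cf fs w; have [w0|w0] := eqVneq w 0; last first.
  apply: cvgM; last exact: cf.
  apply: cvgM; first exact: c1.
  by apply: cvgV; [rewrite lt0r_neq0 // gauge_gt0|exact: c2].
have f0 : f 0 = 0 by apply/eqP; rewrite -normr_le0; apply: le_trans (fs 0) _; rewrite /size1 !normr0 addr0.
subst w; rewrite /continuous_at f0 mulr0; apply/cvgr0Pnorm_le => e e0.
have M0 : 0 <= M1 / m2.
  have := u1 (1, 0); have := l1 (1, 0); rewrite /size1 /= normr1 normr0 addr0 !mulr1.
  by move=> h h'; rewrite divr_ge0 // ltW //; lra.
have fw : f @ (0 : R * R) --> (0 : R) by have := cf 0; rewrite /continuous_at f0.
have K0 : 0 < M1 / m2 + 1 by lra.
move/cvgr0Pnorm_le : fw => /(_ (e / (M1 / m2 + 1)) (divr_gt0 e0 K0)).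
apply: filterS => v fv.
have [->|v0] := eqVneq v 0; first by rewrite f0 mulr0 normr0 ltW.
rewrite normrM (@le_trans _ _ ((M1 / m2 + 1) * `|f v|)) //; last first.
  by rewrite mulrC -ler_pdivlMr.
rewrite ler_wpM2r // ger0_norm; last by rewrite divr_ge0 // ltW // gauge_gt0.
apply: (@le_trans _ _ (M1 / m2)); last lra.
have s0 : 0 <= size1 v by rewrite addr_ge0.
rewrite ler_pdivrMr ?gauge_gt0 // mulrAC ler_pdivlMr //.
apply: (@le_trans _ _ (M1 * size1 v * m2)); first by rewrite ler_pM2r.
rewrite -mulrA ler_wpM2l //; last by rewrite mulrC.
have := u1 (1, 0); have := l1 (1, 0); rewrite /size1 /= normr1 normr0 addr0 !mulr1.
by move=> h h'; lra.
Qed.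

Definition regauge_at N1 o1 N2 o2 z : R * R := o2 + regauge N1 N2 (z - o1).

Lemma regauge_atK N1 o1 N2 o2 : is_gauge N1 -> is_gauge N2 ->
  cancel (regauge_at N1 o1 N2 o2) (regauge_at N2 o2 N1 o1).
Proof.
move=> g1 g2 z; rewrite /regauge_at (addrC o2) addrK regaugeK //.
by rewrite addrC subrK.
Qed.

Lemma regauge_at_continuous N1 o1 N2 o2 : is_gauge N1 -> is_gauge N2 ->
  continuous (regauge_at N1 o1 N2 o2).
Proof.
move=> g1 g2 z; apply: cvgD; first exact: cvg_cst.
apply: (@cvg_comp _ _ _ (fun z => z - o1) (regauge N1 N2)); last exact: regauge_continuous.
by apply: cvgB => //; exact: cvg_cst.
Qed.

Definition gauge_ball N o : set (R * R) := [set z | N (z - o) <= 1].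

Lemma regauge_at_image N1 o1 N2 o2 : is_gauge N1 -> is_gauge N2 ->
  regauge_at N1 o1 N2 o2 @` gauge_ball N1 o1 = gauge_ball N2 o2.
Proof.
move=> g1 g2; apply/seteqP; split=> z.
  move=> [x Nx <-]; rewrite /gauge_ball /regauge_at /=.
  by rewrite (addrC o2) addrK gauge_regauge.
move=> Nz; exists (regauge_at N2 o2 N1 o1 z); last exact: regauge_atK.
by rewrite /gauge_ball /regauge_at /= (addrC o1) addrK gauge_regauge.
Qed.

Lemma homeomorphic_gauge N1 o1 N2 o2 : is_gauge N1 -> is_gauge N2 ->
  homeomorphic (gauge_ball N1 o1) (gauge_ball N2 o2).
Proof.
move=> g1 g2; exists (regauge_at N1 o1 N2 o2), (regauge_at N2 o2 N1 o1); split.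
- exact/continuous_subspaceT/regauge_at_continuous.
- exact/continuous_subspaceT/regauge_at_continuous.
- exact: regauge_at_image.
by move=> z _; apply: regauge_atK.
Qed.

Lemma continuous_maxr (T : topologicalType) (f g : T -> R) :
  continuous f -> continuous g -> continuous (fun x => Num.max (f x) (g x)).
Proof. by move=> cf cg x; exact: continuous_max (cf x) (cg x). Qed.

(** * Rectangles as gauge balls *)

Definition rect (x1 x2 y1 y2 : R) : set (R * R) :=
  [set z | (x1 <= z.1 <= x2) /\ (y1 <= z.2 <= y2)].

(** The Minkowski functional of [[-1/b, 1/a] x [-1/d, 1/c]]. *)
Definition rect_gauge (a b c d : R) w : R :=
  Num.max (Num.max (a * w.1) (- b * w.1)) (Num.max (c * w.2) (- d * w.2)).

Lemma rect_gaugeP a b c d : 0 < a -> 0 < b -> 0 < c -> 0 < d ->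
  is_gauge (rect_gauge a b c d).
Proof.
move=> a0 b0 c0 d0; split.
- have cl (e : R) (f : R * R -> R) : continuous f -> continuous (fun w => e * f w).
    by move=> cf w; apply: cvgM; [exact: cvg_cst|exact: cf].
  apply: continuous_maxr; apply: continuous_maxr; apply: cl;
    by [exact: continuous_fst|exact: continuous_snd].
- move=> t w t0; rewrite /rect_gauge /= !maxr_pMr //.
  by congr (Num.max (Num.max _ _) (Num.max _ _)); rewrite mulrCA.
(* The larger of the two coordinates carries at least half of [size1 w], hence the division by 2. *)
exists (Num.min (Num.min a b) (Num.min c d) / 2), (a + b + c + d).
rewrite /rect_gauge /size1; split=> [|w|w].
- by rewrite divr_gt0 // !lt_min a0 b0 c0.
- set m := Num.min _ _; have [ma mb mc md] : [/\ m <= a, m <= b, m <= c & m <= d].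
    by split; rewrite /m !ge_min lexx ?orbT.
  have m0 : 0 < m by rewrite !lt_min a0 b0 c0.
  have [x0|x0] := leP 0 w.1; have [y0|y0] := leP 0 w.2;
    rewrite ?(ger0_norm x0) ?(ger0_norm y0) ?(ltr0_norm x0) ?(ltr0_norm y0).
  + have : m * w.1 <= a * w.1 by rewrite ler_wpM2r.
    have : m * w.2 <= c * w.2 by rewrite ler_wpM2r.
    by case: (lerP (m * w.1) (m * w.2)) => *; rewrite !le_max; apply/orP;
      [right|left]; apply/orP; left; lra.
  + have : m * w.1 <= a * w.1 by rewrite ler_wpM2r.
    have : m * - w.2 <= d * - w.2 by rewrite ler_wpM2r // oppr_ge0 ltW.
    by case: (lerP (m * w.1) (m * - w.2)) => *; rewrite !le_max; apply/orP;
      [right; apply/orP; right|left; apply/orP; left]; lra.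
  + have : m * - w.1 <= b * - w.1 by rewrite ler_wpM2r // oppr_ge0 ltW.
    have : m * w.2 <= c * w.2 by rewrite ler_wpM2r.
    by case: (lerP (m * - w.1) (m * w.2)) => *; rewrite !le_max; apply/orP;
      [right; apply/orP; left|left; apply/orP; right]; lra.
  have : m * - w.1 <= b * - w.1 by rewrite ler_wpM2r // oppr_ge0 ltW.
  have : m * - w.2 <= d * - w.2 by rewrite ler_wpM2r // oppr_ge0 ltW.
  by case: (lerP (m * - w.1) (m * - w.2)) => *; rewrite !le_max; apply/orP;
    [right|left]; apply/orP; right; lra.
have x1 : w.1 <= `|w.1| by exact: ler_norm.
have x2 : - w.1 <= `|w.1| by rewrite -normrN ler_norm.
have y1 : w.2 <= `|w.2| by exact: ler_norm.
have y2 : - w.2 <= `|w.2| by rewrite -normrN ler_norm.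
have X0 := normr_ge0 w.1; have Y0 := normr_ge0 w.2.
by rewrite !ge_max -!andbA; apply/and4P; split; nra.
Qed.

Lemma rect_gauge_le a b c d w : (rect_gauge a b c d w <= 1) =
  [&& a * w.1 <= 1, - b * w.1 <= 1, c * w.2 <= 1 & - d * w.2 <= 1].
Proof. by rewrite /rect_gauge !ge_max -!andbA. Qed.

Lemma rect_gauge_ball x1 x2 y1 y2 o : x1 < o.1 < x2 -> y1 < o.2 < y2 ->
  gauge_ball (rect_gauge (x2 - o.1)^-1 (o.1 - x1)^-1 (y2 - o.2)^-1 (o.2 - y1)^-1) o =
  rect x1 x2 y1 y2.
Proof.
move=> /andP[h1 h2] /andP[h3 h4]; apply/seteqP; split=> z;
  rewrite /gauge_ball /rect /= rect_gauge_le /= !mulNr -!mulrN !ler_pdivrMl ?subr_gt0 // !mulr1.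
  by case/and4P => *; split; apply/andP; split; lra.
by case=> /andP[? ?] /andP[? ?]; apply/and4P; split; lra.
Qed.

Definition euclid w : R := Num.sqrt (w.1 ^+ 2 + w.2 ^+ 2).

Lemma euclid_gauge : is_gauge euclid.
Proof.
have s0 w : 0 <= w.1 ^+ 2 + w.2 ^+ 2 by rewrite addr_ge0 ?sqr_ge0.
split.
- move=> w; apply: (@continuous_comp _ _ _ (fun w : R * R => w.1 ^+ 2 + w.2 ^+ 2));
    last exact: sqrt_continuous.
  apply: cvgD; rewrite /=; under eq_fun do rewrite expr2.
    by apply: cvgM; exact: continuous_fst.
  by apply: cvgM; exact: continuous_snd.
- move=> t w t0; rewrite /euclid /= !exprMn -mulrDr sqrtrM ?sqr_ge0 //.
  by rewrite sqrtr_sqr ger0_norm.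
exists (1 / 2), 1; split=> // w.
  rewrite /euclid -ler_sqr ?nnegrE ?sqrtr_ge0 ?mulr_ge0 ?addr_ge0 // sqr_sqrtr //.
  rewrite /size1 -(real_normK (num_real w.1)) -(real_normK (num_real w.2)).
  by have := sqr_ge0 (`|w.1| - `|w.2|); nra.
rewrite /euclid -ler_sqr ?nnegrE ?sqrtr_ge0 ?mulr_ge0 ?addr_ge0 // sqr_sqrtr //.
rewrite /size1 -(real_normK (num_real w.1)) -(real_normK (num_real w.2)).
by have := normr_ge0 w.1; have := normr_ge0 w.2; nra.
Qed.

Lemma euclid_ball : gauge_ball euclid 0 = @unit_disk R.
Proof.
have s1 (s : R) : (Num.sqrt s <= 1) = (s <= 1).
  by rewrite -[in LHS]sqrtr1 ler_sqrt.
by apply/seteqP; split=> z; rewrite /gauge_ball /unit_disk /euclid /= !subr0 s1.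
Qed.

Lemma rect_disk x1 x2 y1 y2 : x1 < x2 -> y1 < y2 ->
  homeomorphic (rect x1 x2 y1 y2) (@unit_disk R).
Proof.
move=> h1 h2; rewrite -(@rect_gauge_ball _ _ _ _ ((x1 + x2) / 2, (y1 + y2) / 2)) /=;
  try by apply/andP; split; lra.
rewrite -euclid_ball; apply: homeomorphic_gauge; last exact: euclid_gauge.
by apply: rect_gaugeP; rewrite invr_gt0; lra.
Qed.

Lemma rect_closed x1 x2 y1 y2 : closed (rect x1 x2 y1 y2).
Proof.
have -> : rect x1 x2 y1 y2 = ((fun z : R * R => z.1) @^-1` [set` `[x1, x2]]) `&`
    ((fun z : R * R => z.2) @^-1` [set` `[y1, y2]]).
  by apply/seteqP; split=> z; rewrite /rect /= !in_itv.
apply: closedI; apply: closed_comp; try exact: interval_closed.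
  by move=> z _; exact: continuous_fst.
by move=> z _; exact: continuous_snd.
Qed.

Definition rect_edge (x1 x2 y1 y2 : R) : set (R * R) :=
  rect x1 x2 y1 y2 `&` [set z | [\/ z.1 = x1, z.1 = x2, z.2 = y1 | z.2 = y2]].

Lemma rect_edge_gauge x1 x2 y1 y2 o z : x1 < o.1 < x2 -> y1 < o.2 < y2 ->
  rect_edge x1 x2 y1 y2 z ->
  rect_gauge (x2 - o.1)^-1 (o.1 - x1)^-1 (y2 - o.2)^-1 (o.2 - y1)^-1 (z - o) = 1.
Proof.
move=> ox oy [Kz zE]; apply/eqP; rewrite eq_le; apply/andP; split.
  by have /seteqP[_ h] := rect_gauge_ball ox oy; exact: h Kz.
have /andP[a1 a2] := ox; have /andP[b1 b2] := oy.
have inv (u v : R) : u < v -> - (v - u)^-1 * (u - v) = 1.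
  by move=> uv; rewrite mulNr -mulrN opprB mulVf // lt0r_neq0 // subr_gt0.
have inv' (u v : R) : v < u -> (u - v)^-1 * (u - v) = 1.
  by move=> uv; rewrite mulVf // lt0r_neq0 // subr_gt0.
rewrite /rect_gauge !le_max /=.
by case: zE => ->; rewrite ?(inv _ _ a1) ?(inv _ _ b1) ?(inv' _ _ a2) ?(inv' _ _ b2) lexx ?orbT.
Qed.

(* Radial stretching from the common interior point [o]; it fixes every point
   lying on the edges of both rectangles. *)
Lemma homeomorphic_squash D o x1 x2 y1 y2 u1 u2 v1 v2 : closed D ->
  x1 < o.1 < x2 -> y1 < o.2 < y2 -> u1 < o.1 < u2 -> v1 < o.2 < v2 ->
  rect u1 u2 v1 v2 `<=` rect x1 x2 y1 y2 ->
  (forall z, D z -> rect x1 x2 y1 y2 z ->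
     rect_edge x1 x2 y1 y2 z /\ rect_edge u1 u2 v1 v2 z) ->
  homeomorphic (D `|` rect x1 x2 y1 y2) (D `|` rect u1 u2 v1 v2).
Proof.
move=> cD ox oy ou ov ux DE.
pose N1 := rect_gauge (x2 - o.1)^-1 (o.1 - x1)^-1 (y2 - o.2)^-1 (o.2 - y1)^-1.
pose N2 := rect_gauge (u2 - o.1)^-1 (o.1 - u1)^-1 (v2 - o.2)^-1 (o.2 - v1)^-1.
have /andP[a1 a2] := ox; have /andP[b1 b2] := oy.
have /andP[c1 c2] := ou; have /andP[d1 d2] := ov.
have g1 : is_gauge N1 by apply: rect_gaugeP; rewrite invr_gt0; lra.
have g2 : is_gauge N2 by apply: rect_gaugeP; rewrite invr_gt0; lra.
apply: (@homeomorphic_glue _ D _ _ (regauge_at N1 o N2 o) (regauge_at N2 o N1 o)) => //.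
- exact: rect_closed.
- exact: rect_closed.
- exact: regauge_at_continuous.
- exact: regauge_at_continuous.
- exact: regauge_atK.
- exact: regauge_atK.
- by rewrite -(rect_gauge_ball ox oy) -(rect_gauge_ball ou ov) regauge_at_image.
move=> z Dz Kz; have [|Ez Fz] := DE _ Dz; first by case: Kz => [//|/ux].
split; [exact: Ez.1|exact: Fz.1|].
rewrite /regauge_at regauge_id ?(addrC o) ?subrK //.
by rewrite /N1 /N2 !rect_edge_gauge.
Qed.

(** * Chains of overlapping columns *)

Variables (a : R) (lo hi : nat -> R).

Definition strip (i : nat) : set (R * R) := rect (a + i%:R) (a + i%:R + 1) (lo i) (hi i).

Fixpoint strips (k : nat) : set (R * R) :=
  if k is k'.+1 then strips k' `|` strip k' else set0.

Lemma strips_closed k : closed (strips k).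
Proof.
elim: k => [|k IH] /=; first exact: closed0.
by apply: closedU => //; exact: rect_closed.
Qed.

Lemma strips_le k z : strips k z -> z.1 <= a + k%:R.
Proof.
elim: k => [//|k IH] /= [/IH|[/andP[_ h] _]]; rewrite -natr1 addrA //.
by move=> h; apply: le_trans h _; rewrite lerDl.
Qed.

(** Induction on the number of columns: the last column is retracted into the previous one by two
    applications of [homeomorphic_squash]. *)
Lemma strips_disk k : (forall i, (i <= k)%N -> lo i < hi i) ->
  (forall i, (i < k)%N -> Num.max (lo i) (lo i.+1) < Num.min (hi i) (hi i.+1)) ->
  homeomorphic (strips k.+1) (@unit_disk R).
Proof.
elim: k => [|k IH] lh ov.
  by rewrite /= set0U; apply: rect_disk; [rewrite ltrDl|exact: lh].
apply: homeomorphic_trans (IH _ _); last first.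
- by move=> i ik; apply: ov; apply: ltnW.
- by move=> i ik; apply: lh; apply: leqW.
have := ov _ (ltnSn k); set j0 := Num.max _ _; set j1 := Num.min _ _ => j01.
have [r0 q0 s1 p1] : [/\ lo k <= j0, lo k.+1 <= j0, j1 <= hi k & j1 <= hi k.+1].
  by split; rewrite /j0 /j1 ?le_max ?ge_min lexx ?orbT.
set x := a + k.+1%:R.
have xk : a + k%:R + 1 = x by rewrite -addrA natr1.
have cD := @strips_closed k.+1.
have Dx z : strips k.+1 z -> z.1 <= x by exact: strips_le.
have Dx' z : strips k.+1 z -> z.1 = x -> lo k <= z.2 <= hi k.
  case=> [/strips_le h1 h2|[]//].
  by move: h1; rewrite h2 /x -natr1 addrA => h1; exfalso; lra.
(* First the last column shrinks to the heights it shares with the previous one; all contact points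
   lie on the left edges of both rectangles. *)
apply: (@homeomorphic_trans _ _ _ _ (strips k.+1 `|` rect x (x + 1) j0 j1)).
  rewrite [in X in homeomorphic X _]/= -/(strips k.+1) /strip -/x.
  apply: (@homeomorphic_squash _ (x + 1 / 2, (j0 + j1) / 2)) => //=;
    try by apply/andP; split; lra.
    by move=> z [? /andP[? ?]]; split=> //; apply/andP; split; lra.
  move=> z Dz [/andP[h1 h2] /andP[h3 h4]]; have zx : z.1 = x by have := Dx _ Dz; lra.
  have /andP[h5 h6] := Dx' _ Dz zx.
  have j0z : j0 <= z.2 by rewrite ge_max h5.
  have j1z : z.2 <= j1 by rewrite le_min h6.
  by split; (split; [split; apply/andP; split; lra|constructor 1]).
(* Horizontal cuts at [j0] and [j1] leave a middle band of the previous column, which forms one long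
   rectangle with the shrunken column. That rectangle is then squashed back onto the band. *)
pose D0 := strips k `|` rect (a + k%:R) x (lo k) j0 `|` rect (a + k%:R) x j1 (hi k).
have -> : strips k.+1 `|` rect x (x + 1) j0 j1 = D0 `|` rect (a + k%:R) (x + 1) j0 j1.
  apply/seteqP; split=> z.
  - case=> [[/= ?|[]]|[]]; rewrite ?xk.
    + by left; left; left.
    + move=> /andP[h1 h2] /andP[h3 h4].
      case: (leP z.2 j0) => h5; first by left; left; right; split; apply/andP.
      case: (leP j1 z.2) => h6; first by left; right; split; apply/andP.
      by right; split; apply/andP; split; lra.
    by move=> /andP[h1 h2] ?; right; split=> //; apply/andP; split; lra.
  case=> [[[?|[]]|[]]|[]].
  + by left; left.
  + by move=> ? /andP[? ?]; left; right; split; rewrite ?xk //; apply/andP; split; lra.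
  + by move=> ? /andP[? ?]; left; right; split; rewrite ?xk //; apply/andP; split; lra.
  move=> /andP[h1 h2] /andP[h3 h4]; case: (leP z.1 x) => h5.
    by left; right; split; rewrite ?xk; apply/andP; split; lra.
  by right; split; apply/andP; split; lra.
have e : strips k.+1 = D0 `|` rect (a + k%:R) x j0 j1.
  apply/seteqP; split=> z.
  - case=> [?|[]]; rewrite ?xk; first by left; left; left.
    move=> /andP[h1 h2] /andP[h3 h4].
    case: (leP z.2 j0) => h5; first by left; left; right; split; apply/andP.
    case: (leP j1 z.2) => h6; first by left; right; split; apply/andP.
    by right; split; apply/andP; split; lra.
  case=> [[[?|[]]|[]]|[]]; first by left.
  + by move=> ? /andP[? ?]; right; split; rewrite ?xk //; apply/andP; split; lra.
  + by move=> ? /andP[? ?]; right; split; rewrite ?xk //; apply/andP; split; lra.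
  by move=> ? /andP[? ?]; right; split; rewrite ?xk //; apply/andP; split; lra.
rewrite [X in homeomorphic _ X]e.
apply: (@homeomorphic_squash _ (x - 1 / 2, (j0 + j1) / 2)) => //=;
  try by apply/andP; split; lra.
- by apply: closedU; [apply: closedU; [exact: strips_closed|]|]; exact: rect_closed.
- by move=> z [/andP[? ?] ?]; split=> //; apply/andP; split; lra.
move=> z D0z [/andP[h1 h2] /andP[h3 h4]].
have {D0z} [zx zE] : z.1 <= x /\ [\/ z.1 = a + k%:R, z.2 = j0 | z.2 = j1].
  case: D0z => [[|[]]|[]].
  - by move=> /strips_le h; split; [lra|constructor 1; lra].
  - by move=> /andP[? ?] /andP[? ?]; split=> //; constructor 2; lra.
  by move=> /andP[? ?] /andP[? ?]; split=> //; constructor 3; lra.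
split; (split; first by split; apply/andP; split; lra);
  by case: zE => h; [constructor 1|constructor 3|constructor 4].
Qed.

End Plane.

(** * Absorbing balls of lower level *)

(* The stretching by [2 ^ m] makes a ball comparable to the cones of slope
   [2 ^- m] below, so that packing constants do not depend on the level. *)
Definition anorm (m : nat) (g : Z2) : int := `|g.1| + `|(2 ^ m)%N%:Z * g.2|.

Arguments anorm : simpl never.

Definition cone_le (m : nat) (p q : Z2) : Prop :=
  `|q.1 - p.1| <= (2 ^ m)%N%:Z * (q.2 - p.2).


Lemma anorm_sub m (p q r : Z2) : anorm m (p - r) <= anorm m (p - q) + anorm m (q - r).
Proof. by rewrite /anorm /=; move: (Posz _) => t; lia. Qed.

Lemma anormC m (p q : Z2) : anorm m (p - q) = anorm m (q - p).
Proof. by rewrite /anorm /=; move: (Posz _) => t; lia. Qed.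

Lemma anorm0 m (p : Z2) : anorm m (p - p) = 0.
Proof. by rewrite /anorm /=; move: (Posz _) => t; lia. Qed.

Lemma anormS m g : anorm m g <= anorm m.+1 g <= 2 * anorm m g.
Proof. by rewrite /anorm expnS PoszM; move: (Posz (2 ^ m)) => t; lia. Qed.

Lemma anorm_le1 m (g : Z2) : anorm m g <= (2 ^ m)%N%:Z * (`|g.1| + `|g.2|).
Proof.
rewrite /anorm; have : (1 : int) <= (2 ^ m)%N by have := expn_gt0 2 m; lia.
move: (Posz (2 ^ m)) => t t1; rewrite normrM (@ger0_norm _ t); last by lia.
by rewrite mulrDr lerD2r ler_peMl.
Qed.

Lemma le1_anorm m (g : Z2) : `|g.1| + `|g.2| <= anorm m g.
Proof.
rewrite /anorm; have : (1 : int) <= (2 ^ m)%N by have := expn_gt0 2 m; lia.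
move: (Posz (2 ^ m)) => t t1; rewrite normrM (@ger0_norm _ t); last by lia.
by rewrite lerD2l ler_peMl.
Qed.

Lemma cone_le_refl m p : cone_le m p p.
Proof. by rewrite /cone_le; move: (Posz _) => t; lia. Qed.

Lemma cone_le_trans m p q r : cone_le m p q -> cone_le m q r -> cone_le m p r.
Proof. by rewrite /cone_le; move: (Posz _) => t; lia. Qed.

Lemma cone_leS m p q : cone_le m p q -> cone_le m.+1 p q.
Proof. by rewrite /cone_le expnS PoszM; move: (Posz (2 ^ m)) => t; lia. Qed.

Definition cone_hull (m : nat) (V : set Z2) : set Z2 :=
  [set u | exists p q, [/\ V p, V q, cone_le m q u & cone_le m u p]].

Definition cone_convex (m : nat) (V : set Z2) : Prop := cone_hull m V `<=` V.

Lemma sub_cone_hull m V : V `<=` cone_hull m V.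
Proof. by move=> u Vu; exists u, u; split=> //; apply: cone_le_refl. Qed.

(** By transitivity of the order, one round of adding intervals is enough. *)
Lemma cone_hull_convex m V : cone_convex m (cone_hull m V).
Proof.
move=> u [p [q [[p1 [_ [Vp1 _ _ pp1]]] [_ [q2 [_ Vq2 qq2 _]]] qu up]]].
exists p1, q2; split=> //; first exact: cone_le_trans qu.
exact: cone_le_trans pp1.
Qed.

Definition aball (m : nat) (z : Z2) (r : nat) : set Z2 :=
  [set u | anorm m (u - z) <= r%:Z].

Lemma aballE m z r u : aball m z r u = (anorm m (u - z) <= r%:Z).
Proof. by []. Qed.

(** Above [z], going up a cone of level [m] increases the stretched height at least as much as it
    can decrease the horizontal distance, so [anorm] does not decrease; symmetrically below [z]. *)
Lemma aball_convex m z r : cone_convex m (aball m z r).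
Proof.
move=> u [p [q []]]; rewrite /aball /cone_le /anorm /=.
by move: (Posz (2 ^ m)) => t; lia.
Qed.

(* [growth n] bounds how far (for [anorm n]) absorbing the levels below [n] can
   extend a set, see [grow_near]; the other scales are chosen in terms of it. *)
Fixpoint growth (n : nat) : nat :=
  if n is m.+1 then
    (2 * (growth m + 10 * (5 * (2 ^ m * (m.+1 * (2 * growth m + 16 * 4 ^ m))))))%N
  else 0%N.

(** Spacing of the concentric copies of a piece: room for their growth and for short distances
    measured by [anorm n]. *)
Definition gap (n : nat) : nat := (2 * growth n + 16 * 4 ^ n)%N.
(** The factor [2 ^ n] makes a horizontal step [width n] and a vertical step [n.+1 * gap n] equally
    long for [anorm n]; [n.+1] gaps make room for the copies [j <= n]. *)
Definition width (n : nat) : nat := (2 ^ n * (n.+1 * gap n))%N.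
(** Chosen so that the copies [j <= n] stay inside the ball of radius [attach n] even after growing;
    see [radius_attach]. *)
Definition attach (n : nat) : nat := (5 * width n)%N.

Arguments growth : simpl never.
Arguments gap : simpl never.
Arguments width : simpl never.
Arguments attach : simpl never.

Lemma growthS n : growth n.+1 = (2 * (growth n + 10 * attach n))%N.
Proof. by []. Qed.

Lemma width_ge n : (n.+1 * gap n <= width n)%N.
Proof. by rewrite /width leq_pmull // expn_gt0. Qed.

Definition touched (c : nat -> set Z2) (m : nat) (U : set Z2) : set Z2 :=
  [set z | c m z /\ (U `&` aball m z (attach m)) !=set0].

Definition absorb (c : nat -> set Z2) (m : nat) (U : set Z2) : set Z2 :=
  U `|` [set v | exists2 z, touched c m U z & aball m z (attach m) v].

Definition step c m U : set Z2 := cone_hull m (absorb c m U).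

Fixpoint grow (c : nat -> set Z2) (n : nat) (U : set Z2) : set Z2 :=
  if n is m.+1 then grow c m (step c m U) else U.

Lemma step_convex c m U : cone_convex m (step c m U).
Proof. exact: cone_hull_convex. Qed.

Lemma sub_step c m U : U `<=` step c m U.
Proof. by move=> u Uu; apply: sub_cone_hull; left. Qed.

Lemma sub_grow c n U : U `<=` grow c n U.
Proof.
elim: n U => [|n IH] U u Uu //=; apply: IH; exact: sub_step.
Qed.

Lemma grow_convex c n U : cone_convex n U -> cone_convex 0 (grow c n U).
Proof. by elim: n U => [|n IH] U cU //=; apply: IH; apply: step_convex. Qed.

(* A point far below [p] in the order of level [m] is already below the nearby
   point [u] in the wider cones of level [m.+1]. *)
Lemma near_or_below m (u p v : Z2) (r : int) :
  anorm m (u - p) <= 2 * r -> cone_le m v p ->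
  anorm m (v - p) <= 8 * r \/ cone_le m.+1 v u.
Proof.
rewrite /cone_le /anorm /= expnS PoszM; move: (Posz (2 ^ m)) => t h1 h2.
by case: (lerP (4 * r) (t * (p.2 - v.2))) => h; [right|left]; lia.
Qed.

Lemma near_or_above m (u p v : Z2) (r : int) :
  anorm m (u - p) <= 2 * r -> cone_le m p v ->
  anorm m (v - p) <= 8 * r \/ cone_le m.+1 u v.
Proof.
rewrite /cone_le /anorm /= expnS PoszM; move: (Posz (2 ^ m)) => t h1 h2.
by case: (lerP (4 * r) (t * (v.2 - p.2))) => h; [right|left]; lia.
Qed.

(** A new point lies between two points that are in [U] or in absorbed balls, hence close to [U].
    Unless it is close to a touched marker, it lies between two points of [U] for the wider cones,
    so it was already in [U]. *)
Lemma step_local c m U v : cone_convex m.+1 U -> step c m U v ->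
  U v \/ exists2 z, touched c m U z & anorm m (v - z) <= 9 * (attach m)%:Z.
Proof.
move=> cU [p [q [Vp Vq qv vp]]].
have up : (exists2 z, touched c m U z & anorm m (v - z) <= 9 * (attach m)%:Z) \/
    exists2 u, U u & cone_le m.+1 v u.
  case: Vp => [Up|[z tz zp]]; first by right; exists p => //; apply: cone_leS.
  have [cz [u [Uu zu]]] := tz.
  have pu : anorm m (u - p) <= 2 * (attach m)%:Z.
    by have := anorm_sub m u z p; rewrite (anormC m z p);
      move: zu zp; rewrite ?aballE; lia.
  case: (near_or_below pu vp) => h; last by right; exists u.
  by left; exists z => //; have := anorm_sub m v p z; move: zp; rewrite ?aballE; lia.
have dn : (exists2 z, touched c m U z & anorm m (v - z) <= 9 * (attach m)%:Z) \/
    exists2 u, U u & cone_le m.+1 u v.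
  case: Vq => [Uq|[z tz zp]]; first by right; exists q => //; apply: cone_leS.
  have [cz [u [Uu zu]]] := tz.
  have pu : anorm m (u - q) <= 2 * (attach m)%:Z.
    by have := anorm_sub m u z q; rewrite (anormC m z q);
      move: zu zp; rewrite ?aballE; lia.
  case: (near_or_above pu qv) => h; last by right; exists u.
  by left; exists z => //; have := anorm_sub m v q z; move: zp; rewrite ?aballE; lia.
case: up => [?|[u Uu vu]]; first by right.
case: dn => [?|[u' Uu' vu']]; first by right.
by left; apply: cU; exists u, u'.
Qed.

(** Level [m] costs [9 * attach m] to reach a marker and [attach m] to reach [U] from there; the
    factor 2 in [growth] converts [anorm m] into [anorm m.+1]. *)
Lemma grow_near c n U v : cone_convex n U -> grow c n U v ->
  exists2 u, U u & anorm n (v - u) <= (growth n)%:Z.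
Proof.
elim: n U => [|n IH] U cU /=; first by move=> Uv; exists v => //; rewrite anorm0.
move=> /(IH _ (@step_convex _ _ _)) [u su vu].
have [Uu|[z [cz [u' [Uu' zu']]] uz]] := step_local cU su.
  exists u => //; have := anormS n (v - u); move: vu; rewrite growthS. lia.
exists u' => //.
have := anormS n (v - u'); have := anorm_sub n v u u'.
have := anorm_sub n u z u'; rewrite (anormC n z u'); move: zu' vu uz.
rewrite ?aballE growthS; lia.
Qed.

Lemma grow_aball c n z r v : grow c n (aball n z r) v ->
  anorm n (v - z) <= (r + growth n)%N%:Z.
Proof.
move=> /(grow_near (@aball_convex _ _ _)) [u zu vu].
by have := anorm_sub n v u z; move: zu; rewrite ?aballE; lia.
Qed.

Definition sparse (c : nat -> set Z2) : Prop := forall n z z',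
  c n z -> c n z' -> anorm n (z' - z) <= (50 * width n)%N%:Z -> z' = z.

(** When level [m] is treated, the ball at [z] is absorbed whole if it is touched. Otherwise the set
    remains outside it at that level, and the lower levels move points by at most [growth m]. *)
Lemma grow_dichotomy c m n U z : sparse c -> cone_convex n U -> (m < n)%N ->
  c m z -> aball m z (attach m) `<=` grow c n U \/
  forall v, grow c n U v -> (attach m)%:Z - (growth m)%:Z < anorm m (v - z).
Proof.
move=> sc; elim: n U => [//|n IH] U cU; rewrite ltnS leq_eqVlt => /predU1P[->|mn] cz.
  have [tz|ntz] := pselect (touched c n U z).
    left=> v zv /=; apply: sub_grow; apply: sub_cone_hull; right.
    by exists z.
  right=> v /= /(grow_near (@step_convex _ _ _)) [u su vu].
  have zu : (attach n)%:Z < anorm n (u - z).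
    rewrite ltNge; apply/negP => zu.
    have [Uu|[z' [cz' tz'] uz']] := step_local cU su.
      by apply: ntz; split=> //; exists u.
    (* Distances [attach n] to [z] and [9 * attach n] to [z'] add up to [50 * width n], the constant
       in [sparse]. *)
    apply: ntz; suff -> : z = z' by [].
    apply: (sc n) => //; have := anorm_sub n z u z'; rewrite (anormC n z u).
    by move: zu uz'; rewrite /attach; lia.
  by have := anorm_sub n u v z; rewrite (anormC n u v); lia.
exact: IH (@step_convex _ _ _) mn cz.
Qed.

(** * Pieces and the induced equivalence relations *)

Section Pieces.
Implicit Types (a b d p q u v w x y z : Z2) (c : nat -> set Z2).

(** The base [3 * width n] is the covering distance of [covering]; the second term keeps the
    boundaries used by different partitions [j] apart around one marker. *)
Definition radius (n j : nat) : nat := (3 * width n + j * gap n)%N.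
Arguments radius : simpl never.

Lemma gapE n : gap n = (2 * growth n + 16 * 4 ^ n)%N. Proof. by []. Qed.
Lemma attachE n : attach n = (5 * width n)%N. Proof. by []. Qed.

Lemma radius_ltn n j j' : (j < j')%N ->
  (radius n j + 2 * growth n + 16 * 4 ^ n <= radius n j')%N.
Proof.
move=> jj'; have : (j.+1 * gap n <= j' * gap n)%N by rewrite leq_mul2r jj' orbT.
by have := gapE n; rewrite /radius mulSn; lia.
Qed.

Lemma radius_attach n j : (j <= n)%N ->
  (radius n j + 2 * growth n + 16 * 4 ^ n <= attach n)%N.
Proof.
move=> jn; have : (j.+1 * gap n <= n.+1 * gap n)%N by rewrite leq_mul2r ltnS jn orbT.
have := width_ge n; have := gapE n; rewrite /radius attachE; move: (2 ^ n)%N (4 ^ n)%N.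
by move=> _ f; rewrite mulSn; lia.
Qed.

(* The piece of level [n] at [z] is [piece c n n z]; its smaller concentric copies
   [piece c n j z], [j < n], carry the boundaries of the partition of level [j]. *)
Definition piece c (n j : nat) (z : Z2) : set Z2 := grow c n (aball n z (radius n j)).

Lemma sub_piece c n j z u :
  anorm n (u - z) <= (radius n j)%:Z -> piece c n j z u.
Proof. by move=> h; apply: sub_grow; rewrite aballE. Qed.

Lemma piece_radius c n j z u : piece c n j z u ->
  anorm n (u - z) <= (radius n j + growth n)%N%:Z.
Proof. exact: grow_aball. Qed.

Definition l1 (g : Z2) : int := `|g.1| + `|g.2|.

Lemma l1_sub (p q r : Z2) : l1 (p - r) <= l1 (p - q) + l1 (q - r).
Proof. by rewrite /l1 /=; lia. Qed.

Lemma l1C (p q : Z2) : l1 (p - q) = l1 (q - p).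
Proof. by rewrite /l1 /=; lia. Qed.

Lemma anorm_l1 m g (r : nat) : l1 g <= r%:Z -> anorm m g <= (2 ^ m * r)%N%:Z.
Proof.
by move=> h; apply: le_trans (anorm_le1 m g) _; rewrite PoszM ler_wpM2l.
Qed.

(** This is where the term [4 ^ n] of [gap] comes from: [2 ^ l] for the distance and [2 ^ n] for the
    stretching. *)
Lemma anorm_scale l n g k : (l <= n)%N -> l1 g <= (k * 2 ^ l)%N%:Z ->
  anorm n g <= (k * 4 ^ n)%N%:Z.
Proof.
move=> ln /(@anorm_l1 n) h; apply: le_trans h _; rewrite lez_nat mulnCA leq_mul2l.
by rewrite -[4%N]/(2 * 2)%N expnMn leq_mul2l leq_exp2l ?ln ?orbT.
Qed.

Lemma exp2_le4 n : (2 ^ n <= 4 ^ n)%N.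
Proof. by case: n => // n; rewrite leq_exp2r. Qed.

Section Levels.
Variable c : nat -> set Z2.
Hypothesis sc : sparse c.

(** The part of an absorbed ball that no piece of higher level can cut: the second alternative of
    [grow_dichotomy] keeps such a piece entirely out of it. *)
Definition core (m : nat) (z v : Z2) : Prop :=
  anorm m (v - z) + (growth m)%:Z <= (attach m)%:Z.

Lemma piece_core m i z u : (i <= m)%N -> piece c m i z u -> core m z u.
Proof.
by move=> /radius_attach h /piece_radius; rewrite /core; lia.
Qed.

Lemma core_same m n j z z' u v : (m < n)%N -> c m z' ->
  core m z' u -> core m z' v -> piece c n j z u -> piece c n j z v.
Proof.
move=> mn cz'; rewrite /core => zu zv pu.
have [inn|out] := grow_dichotomy sc (@aball_convex n z (radius n j)) mn cz'.
  by apply: inn; rewrite aballE; lia.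
by have := out _ pu; lia.
Qed.

(** Each core has radius at most [5 * width n], and [4 ^ n] is small against [width n], so
    sparseness applies. *)
Lemma core_center n z z' u u' : c n z -> c n z' -> core n z u -> core n z' u' ->
  anorm n (u - u') <= (40 * 4 ^ n)%N%:Z -> z = z'.
Proof.
move=> cz cz'; rewrite /core => zu zu' uu'; apply: (@sc n) => //.
have := anorm_sub n z u z'; have := anorm_sub n u u' z'; rewrite (anormC n z u).
have := width_ge n; rewrite attachE in zu zu' *; have := gapE n.
by rewrite mulSn; lia.
Qed.

Lemma piece_center n i j z z' u : (i <= n)%N -> (j <= n)%N -> c n z -> c n z' ->
  piece c n i z u -> piece c n j z' u -> z = z'.
Proof.
move=> /piece_core hi /piece_core hj cz cz' /hi zu /hj z'u.
by apply: core_center zu z'u _; rewrite // anorm0.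
Qed.

Definition first (j n : nat) (z x : Z2) : Prop :=
  [/\ (j <= n)%N, c n z, piece c n j z x &
      forall m z', (j <= m < n)%N -> c m z' -> ~ piece c m j z' x].

Definition top (j m : nat) (z x : Z2) : Prop :=
  [/\ (m < j)%N, c m z, piece c m m z x &
      forall m' z', (m < m' < j)%N -> c m' z' -> ~ piece c m' m' z' x].

Lemma first_uniq j n n' z z' x : first j n z x -> first j n' z' x ->
  n = n' /\ z = z'.
Proof.
move=> [jn cz zx nx] [jn' cz' z'x n'x]; case: (ltngtP n n') => [h|h|h].
- by case: (n'x n z); rewrite ?jn.
- by case: (nx n' z'); rewrite ?jn'.
by subst n'; split=> //; apply: piece_center zx z'x.
Qed.

Lemma top_uniq j n n' z z' x : top j n z x -> top j n' z' x -> n = n' /\ z = z'.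
Proof.
move=> [jn cz zx nx] [jn' cz' z'x n'x]; case: (ltngtP n n') => [h|h|h].
- by case: (nx n' z'); rewrite ?h.
- by case: (n'x n z); rewrite ?h.
by subst n'; split=> //; apply: piece_center zx z'x.
Qed.

(** Classes are the fibres of [first], except that the fibres of level [n = j] are cut further into
    maximal lower pieces; the points of those fibres outside all lower pieces are singletons by the
    first clause. *)
Definition eqv (j : nat) (x y : Z2) : Prop :=
  [\/ x = y,
      exists n z, [/\ (j < n)%N, first j n z x & first j n z y] |
      exists z m z', [/\ first j j z x, first j j z y, top j m z' x & top j m z' y]].

Lemma eqv_refl j x : eqv j x x. Proof. by constructor 1. Qed.

Lemma eqv_sym j x y : eqv j x y -> eqv j y x.
Proof.
case=> [->|[n [z [? ? ?]]]|[z [m [z' [? ? ? ?]]]]]; first exact: eqv_refl.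
  by constructor 2; exists n, z.
by constructor 3; exists z, m, z'.
Qed.

Lemma eqv_trans j x y w : eqv j x y -> eqv j y w -> eqv j x w.
Proof.
case=> [->//|[n [z [jn fx fy]]]|[z [m [z' [fx fy tx ty]]]]].
- case=> [<-|[n1 [z1 [jn1 fy1 fw]]]|[z1 [m1 [z1' [fy1 fw ty1 tw]]]]].
  + by constructor 2; exists n, z.
  + by have [? ?] := first_uniq fy fy1; subst; constructor 2; exists n1, z1.
  + by have [? ?] := first_uniq fy fy1; subst; rewrite ltnn in jn.
case=> [<-|[n1 [z1 [jn1 fy1 fw]]]|[z1 [m1 [z1' [fy1 fw ty1 tw]]]]].
- by constructor 3; exists z, m, z'.
- by have [? ?] := first_uniq fy fy1; subst; rewrite ltnn in jn1.
have [_ ?] := first_uniq fy fy1; have [? ?] := top_uniq ty ty1; subst.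
by constructor 3; exists z1, m1, z1'.
Qed.

Lemma top_exists j m z x : (m < j)%N -> c m z -> piece c m m z x ->
  exists m' z', (m <= m')%N /\ top j m' z' x.
Proof.
move=> mj cz zx.
pose Q m' := `[< (m' < j)%N /\ exists2 z', c m' z' & piece c m' m' z' x >].
have Qm : Q m by apply/asboolP; split=> //; exists z.
have Qle m' : Q m' -> (m' <= j)%N by move=> /asboolP[/ltnW].
case: (ex_maxnP (ex_intro _ m Qm) Qle) => M /asboolP[Mj [z' cz' z'x]] Mmax.
exists M, z'; split; first exact: Mmax.
split=> // m' z1 /andP[Mm' m'j] cz1 z1x.
suff : (m' <= M)%N by rewrite leqNgt Mm'.
by apply: Mmax; apply/asboolP; split=> //; exists z1.
Qed.

Lemma first_exists j n z x : (j <= n)%N -> c n z -> piece c n j z x ->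
  exists n' z', (n' <= n)%N /\ first j n' z' x.
Proof.
move=> jn cz zx.
pose Q m := `[< (j <= m)%N /\ exists2 z', c m z' & piece c m j z' x >].
have Qn : Q n by apply/asboolP; split=> //; exists z.
case: (ex_minnP (ex_intro _ n Qn)) => M /asboolP[jM [z' cz' z'x]] Mmin.
exists M, z'; split; first exact: Mmin.
split=> // m' z1 /andP[jm' m'M] cz1 z1x.
suff : (M <= m')%N by rewrite leqNgt m'M.
by apply: Mmin; apply/asboolP; split=> //; exists z1.
Qed.

(* Pieces of higher level contain all or nothing of a piece of level [m]. *)
Lemma top_piece j m m' z z' x y : (m < j)%N -> c m z -> piece c m m z x ->
  piece c m m z y -> (m <= m')%N -> top j m' z' x -> top j m' z' y.
Proof.
move=> mj cz zx zy mm' [m'j cz' z'x mx].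
have cx := piece_core (leqnn m) zx; have cy := piece_core (leqnn m) zy.
split=> //; last first.
  move=> m1 z1 /andP[h1 h2] cz1 z1y; apply: (mx m1 z1); rewrite ?h1 //.
  exact: (core_same (leq_ltn_trans mm' h1) cz cy cx z1y).
move: mm'; rewrite leq_eqVlt => /predU1P[mm'|mm'].
  by subst m'; rewrite -(piece_center (leqnn m) (leqnn m) cz cz' zx z'x).
exact: (core_same mm' cz cx cy z'x).
Qed.

Lemma first_piece j m n z z' x y : (m < n)%N -> (m < j)%N -> c m z ->
  piece c m m z x -> piece c m m z y -> first j n z' x -> first j n z' y.
Proof.
move=> mn mj cz zx zy [jn cz' z'x nx].
have cx := piece_core (leqnn m) zx; have cy := piece_core (leqnn m) zy.
split=> //; first exact: (core_same mn cz cx cy z'x).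
move=> m1 z1 /andP[h1 h2] cz1 z1y; apply: (nx m1 z1); rewrite ?h1 //.
exact: (core_same (leq_trans mj h1) cz cy cx z1y).
Qed.

(** The common lower piece need not be maximal: a maximal one containing [x] also contains [y]. *)
Lemma first_eqv j n z x y : first j n z x -> first j n z y ->
  (n = j -> exists m z', [/\ (m < j)%N, c m z', piece c m m z' x & piece c m m z' y]) ->
  eqv j x y.
Proof.
move=> fx fy; have [jn _ _ _] := fx.
move: jn; rewrite leq_eqVlt => /predU1P[jn|jn _]; last by constructor 2; exists n, z.
subst n => /(_ erefl) [m [z' [mj cz' z'x z'y]]].
have [m1 [z1 [mm1 tx]]] := top_exists mj cz' z'x.
constructor 3; exists z, m1, z1; split=> //.
exact: (top_piece mj cz' z'x z'y mm1 tx).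
Qed.

Lemma piece_eqv j m z x y : (m < j)%N -> c m z -> piece c m m z x ->
  piece c m m z y -> (exists n z', first j n z' x) -> eqv j x y.
Proof.
move=> mj cz zx zy [n [z' fx]]; have [jn _ _ _] := fx.
have fy := first_piece (leq_trans mj jn) mj cz zx zy fx.
by apply: (first_eqv fx fy) => _; exists m, z.
Qed.

Definition covering : Prop := forall x j, exists n z,
  [/\ (j <= n)%N, c n z & anorm n (x - z) <= (3 * width n)%N%:Z].
Hypothesis cc : covering.

Lemma first_total j x : exists n z, first j n z x.
Proof.
have [n [z [jn cz xz]]] := cc x j.
have [|n' [z' [_ h]]] := first_exists (x := x) jn cz; last by exists n', z'.
by apply: sub_piece; move: xz; rewrite /radius; lia.
Qed.

(** * Boundaries of three distinct partitions are never close *)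

Definition edge_point (j : nat) (x : Z2) : Prop :=
  exists2 y, l1 (x - y) <= 1 & ~ eqv j x y.

(** Metric traces of being next to the boundary of [piece c n j z]: near its initial radius up to
    growth, and essentially outside the cores of lower level. The slack [2 ^ m] bounds [anorm m] of
    a unit step. *)
Definition loop_at (j n : nat) (z x : Z2) : Prop :=
  [/\ (radius n j)%:Z <= anorm n (x - z) + (2 ^ n)%N%:Z,
      anorm n (x - z) <= (radius n j + growth n + 2 ^ n)%N%:Z &
      forall m z', (m < n)%N -> c m z' ->
        (attach m)%:Z < anorm m (x - z') + (growth m + 2 ^ m)%N%:Z].

Definition solid_at (j : nat) (z x : Z2) : Prop :=
  piece c j j z x /\
  exists2 y, l1 (x - y) <= 1 &
    forall m z', (m < j)%N -> c m z' -> ~ (piece c m m z' x /\ piece c m m z' y).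

(* Each boundary point of level [j] comes either from the boundary of a copy
   [piece c n j z] or from the inside of a piece of level [j]. *)
Definition carrier (j n : nat) (z x : Z2) : Prop :=
  [/\ (j <= n)%N, c n z & loop_at j n z x \/ n = j /\ solid_at j z x].

Lemma loop_atP j n z x y : c n z -> l1 (x - y) <= 1 ->
  ~ (piece c n j z x <-> piece c n j z y) -> loop_at j n z x.
Proof.
move=> cz xy nxy.
have dxy m : anorm m (x - y) <= (2 ^ m)%N%:Z by have := anorm_l1 m xy; rewrite muln1.
have tri := anorm_sub n x y z; have tri' := anorm_sub n y x z.
rewrite (anormC n y x) in tri'; have dn := dxy n.
split.
- rewrite leNgt; apply/negP => h; apply: nxy; split=> _; apply: sub_piece; lia.
- rewrite leNgt; apply/negP => h; apply: nxy; split=> /piece_radius h'; exfalso; lia.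
move=> m z' mn cz'; rewrite ltNge; apply/negP => h; apply: nxy.
have cx : core m z' x by rewrite /core; lia.
have cy : core m z' y.
  have := anorm_sub m y x z'; have := dxy m; rewrite /core (anormC m x y); lia.
split; first exact: (core_same mn cz' cx cy).
exact: (core_same mn cz' cy cx).
Qed.

(** If the neighbours have different [first] data, the copy of smaller level (or either copy, at
    equal levels) contains only one of them. If the data agree, only the subdivision inside a piece
    of level [j] can separate them. *)
Lemma edge_carrier j x : edge_point j x -> exists n z, carrier j n z x.
Proof.
move=> [y xy nxy].
have [n [z fx]] := first_total j x; have [n' [z' fy]] := first_total j y.
have [jn cz zx nx] := fx; have [jn' cz' z'y ny] := fy.
case: (ltngtP n n') => [h|h|h].
- exists n, z; split=> //; left; apply: (loop_atP cz xy).
  by move=> [/(_ zx) zy _]; apply: (ny n z); rewrite ?jn.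
- exists n', z'; split=> //; left; apply: (loop_atP cz' xy).
  by move=> [_ /(_ z'y) z'x]; apply: (nx n' z'); rewrite ?jn'.
subst n'; have [zz'|zz'] := pselect (z = z'); last first.
  exists n, z; split=> //; left; apply: (loop_atP cz xy) => -[/(_ zx) zy _].
  by apply: zz'; apply: (piece_center (u := y) jn jn).
subst z'; exists n, z; split=> //; right.
have nj : n = j.
  case: (ltngtP j n) jn => // h _; case: nxy.
  by apply: (first_eqv fx fy) => e; rewrite e ltnn in h.
split=> //; subst n; split=> //; exists y => // m z' mj cz1 [z1x z1y].
by apply: nxy; apply: (first_eqv fx fy) => _; exists m, z'.
Qed.

Lemma carrier_radius j n z x : carrier j n z x ->
  anorm n (x - z) <= (radius n j + growth n + 2 ^ n)%N%:Z.
Proof.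
by move=> [jn cz [[_ h _]//|[? [/piece_radius h _]]]]; subst n; apply: le_trans h _; lia.
Qed.

(** The point [b] is too close to [za] for a loop of the higher level [nb], so it is solid. If
    [ja < na], the full piece at [za] would contain both [b] and its neighbour, against solidity. *)
Lemma carrier_nested l ja na za a jb nb zb b : (l <= ja)%N -> (na < nb)%N ->
  l1 (a - b) <= (2 * 2 ^ l)%N%:Z ->
  carrier ja na za a -> carrier jb nb zb b ->
  [/\ ja = na, nb = jb & solid_at jb zb b].
Proof.
move=> lj nn ab ca cb; have ra := carrier_radius ca.
have [jan cza _] := ca; have [jbn czb kb] := cb.
have dab := anorm_scale (leq_trans lj jan) ab.
have tri := anorm_sub na b a za; rewrite (anormC na b a) in tri.
have rat := radius_attach jan; have e24 := exp2_le4 na.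
case: kb => [[_ _ /(_ _ _ nn cza)]|[? sb]]; first by lia.
subst nb; split=> //; have [pb [y yb /(_ _ _ nn cza) nb]] := sb.
apply/eqP; rewrite eqn_leq jan leqNgt; apply/negP => h.
have rlt := radius_ltn na h.
have yb' := anorm_l1 na yb; rewrite muln1 anormC in yb'.
have tri' := anorm_sub na y b za.
by apply: nb; split; apply: sub_piece; lia.
Qed.

(** Sparseness forces the same marker; the gap between the two radii then excludes a loop at [b]. *)
Lemma carrier_same l ja jb n za zb a b : (l <= ja)%N -> (ja < jb)%N ->
  l1 (a - b) <= (2 * 2 ^ l)%N%:Z ->
  carrier ja n za a -> carrier jb n zb b -> jb = n.
Proof.
move=> lj jj ab ca cb; have ra := carrier_radius ca; have rb := carrier_radius cb.
have [jan cza _] := ca; have [jbn czb kb] := cb.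
have dab := anorm_scale (leq_trans lj jan) ab.
have e24 := exp2_le4 n; have rat := radius_attach jan; have rbt := radius_attach jbn.
have zz : za = zb.
  apply: (@core_center n za zb a b) => //; rewrite /core; lia.
subst zb; case: kb => [[h _ _]|[]//].
have rlt := radius_ltn n jj.
by have := anorm_sub n b a za; rewrite (anormC n b a); lia.
Qed.

(** All the points lie in the core of [za], and [b] is in the piece at [zb]. That piece therefore
    contains [d] and its neighbour too, against the solidity of [d]. *)
Lemma carrier_chain l ja na za a jb nb zb b jd nd zd d :
  (l <= ja)%N -> (l <= jb)%N -> (na < nb)%N -> (nb < nd)%N ->
  l1 (a - b) <= (2 * 2 ^ l)%N%:Z -> l1 (b - d) <= (2 * 2 ^ l)%N%:Z ->
  l1 (a - d) <= (2 * 2 ^ l)%N%:Z ->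
  carrier ja na za a -> carrier jb nb zb b -> carrier jd nd zd d -> False.
Proof.
move=> lja ljb ab bd dab dbd dad ca cb cd; have ra := carrier_radius ca.
have [_ ? [pb _]] := carrier_nested lja ab dab ca cb.
have [_ ? [_ [y yd nd']]] := carrier_nested ljb bd dbd cb cd.
subst nb nd; have [jan cza _] := ca; have [_ czb _] := cb.
have rat := radius_attach jan; have e24 := exp2_le4 na.
have aab := anorm_scale (leq_trans lja jan) dab.
have aad := anorm_scale (leq_trans lja jan) dad.
have yd' := anorm_l1 na yd; rewrite muln1 anormC in yd'.
have t1 := anorm_sub na b a za; rewrite (anormC na b a) in t1.
have t2 := anorm_sub na d a za; rewrite (anormC na d a) in t2.
have t3 := anorm_sub na y d za.
apply: (nd' jb zb bd czb).
by split; apply: (core_same ab cza _ _ pb); rewrite /core; lia.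
Qed.

(** At a single level, the larger index of any two equals that level, so two indices coincide. If
    exactly two levels coincide, [carrier_nested] equates both their indices with that level.
    Distinct levels are the case of [carrier_chain]. *)
Lemma no_triple_sorted l ja na za a jb nb zb b jd nd zd d :
  (l <= ja)%N -> (l <= jb)%N -> (l <= jd)%N ->
  ja != jb -> jb != jd -> ja != jd -> (na <= nb)%N -> (nb <= nd)%N ->
  l1 (a - b) <= (2 * 2 ^ l)%N%:Z -> l1 (b - d) <= (2 * 2 ^ l)%N%:Z ->
  l1 (a - d) <= (2 * 2 ^ l)%N%:Z ->
  carrier ja na za a -> carrier jb nb zb b -> carrier jd nd zd d -> False.
Proof.
move=> la lb ld ab bd ad; rewrite leq_eqVlt => /predU1P[nab|nab];
  rewrite leq_eqVlt => /predU1P[nbd|nbd] dab dbd dad ca cb cd.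
- subst nb nd; have dba := dab; have ddb := dbd; have dda := dad.
  rewrite l1C in dba; rewrite l1C in ddb; rewrite l1C in dda.
  have AB : ja = na \/ jb = na.
    case: (ltngtP ja jb) ab => // h _; first by right; apply: carrier_same h dab ca cb.
    by left; apply: carrier_same h dba cb ca.
  have BD : jb = na \/ jd = na.
    case: (ltngtP jb jd) bd => // h _; first by right; apply: carrier_same h dbd cb cd.
    by left; apply: carrier_same h ddb cd cb.
  have AD : ja = na \/ jd = na.
    case: (ltngtP ja jd) ad => // h _; first by right; apply: carrier_same h dad ca cd.
    by left; apply: carrier_same h dda cd ca.
  by case: AB => e1; case: BD => e2; case: AD => e3; move: ab bd ad;
    rewrite ?e1 ?e2 ?e3 ?eqxx.
- have [eb _ _] := carrier_nested lb nbd dbd cb cd.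
  have [ea _ _] := carrier_nested la (leq_ltn_trans (eq_leq nab) nbd) dad ca cd.
  by move: ab; rewrite ea eb nab eqxx.
- have [_ eb _] := carrier_nested la nab dab ca cb.
  have [_ ed _] := carrier_nested la (leq_trans nab (eq_leq nbd)) dad ca cd.
  by move: bd; rewrite -eb -ed nbd eqxx.
exact: (carrier_chain la lb nab nbd dab dbd dad ca cb cd).
Qed.

Lemma no_triple l ja a jb b jd d :
  (l <= ja)%N -> (l <= jb)%N -> (l <= jd)%N ->
  ja != jb -> jb != jd -> ja != jd ->
  l1 (a - b) <= (2 ^ l)%N%:Z -> l1 (b - d) <= (2 ^ l)%N%:Z ->
  edge_point ja a -> edge_point jb b -> edge_point jd d -> False.
Proof.
move=> la lb ld ab bd ad dab dbd.
move=> /edge_carrier[na [za ca]] /edge_carrier[nb [zb cb]] /edge_carrier[nd [zd cd]].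
(* The factor 2 comes from the triangle inequality and makes the bound symmetric, so that the three
   points can be sorted by level. *)
have {}dab : l1 (a - b) <= (2 * 2 ^ l)%N%:Z /\ l1 (b - a) <= (2 * 2 ^ l)%N%:Z /\
  l1 (b - d) <= (2 * 2 ^ l)%N%:Z /\ l1 (d - b) <= (2 * 2 ^ l)%N%:Z /\
  l1 (a - d) <= (2 * 2 ^ l)%N%:Z /\ l1 (d - a) <= (2 * 2 ^ l)%N%:Z.
  have := l1_sub a b d; rewrite (l1C b a) (l1C d b) (l1C d a); lia.
case: dab => d1 [d2 [d3 [d4 [d5 d6]]]].
have ba : jb != ja by rewrite eq_sym.
have db : jd != jb by rewrite eq_sym.
have da : jd != ja by rewrite eq_sym.
case: (leqP na nb) => h1; case: (leqP nb nd) => h2; case: (leqP na nd) => h3.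
- exact: (no_triple_sorted la lb ld ab bd ad h1 h2 d1 d3 d5 ca cb cd).
- exact: (no_triple_sorted la lb ld ab bd ad h1 h2 d1 d3 d5 ca cb cd).
- exact: (no_triple_sorted la ld lb ad db ab h3 (ltnW h2) d5 d4 d1 ca cd cb).
- exact: (no_triple_sorted ld la lb da ab db (ltnW h3) h1 d6 d1 d4 cd ca cb).
- exact: (no_triple_sorted lb la ld ba ad bd (ltnW h1) h3 d2 d5 d3 cb ca cd).
- exact: (no_triple_sorted lb ld la bd da ba h2 (ltnW h3) d3 d6 d2 cb cd ca).
- exact: (no_triple_sorted ld lb la db ba da (ltnW h2) (ltnW h1) d4 d2 d6 cd cb ca).
- exact: (no_triple_sorted ld lb la db ba da (ltnW h2) (ltnW h1) d4 d2 d6 cd cb ca).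
Qed.

(* If [n >= k] is minimal with [x] in a piece of level [n], then [x] is either
   alone in its class at level [n] or in a piece of level below [k]. *)
Lemma atom_shape k x : exists n, (k <= n)%N /\
  ((forall y, eqv n x y -> y = x) \/
   exists m z, [/\ (m < k)%N, c m z, piece c m m z x,
     forall y, eqv n x y -> piece c m m z y &
     forall y j, (k <= j)%N -> piece c m m z y -> eqv j x y]).
Proof.
have [N [zN [kN cN zNx]]] := cc x k.
pose Q n := `[< (k <= n)%N /\ exists2 z, c n z & piece c n n z x >].
have QN : Q N.
  apply/asboolP; split=> //; exists zN => //; apply: sub_piece.
  by move: zNx; rewrite /radius; lia.
case: (ex_minnP (ex_intro _ N QN)) => n /asboolP[kn [z cz zx]] nmin.
exists n; split=> //.
have fx : first n n z x by split=> // m z' /andP[h1 h2]; move: (leq_ltn_trans h1 h2); rewrite ltnn.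
have [[m [z' tx]]|notop] := pselect (exists m z', top n m z' x).
  right; exists m, z'; have [mn cz' z'x _] := tx.
  have mk : (m < k)%N.
    rewrite ltnNge; apply/negP => km.
    have : (n <= m)%N by apply: nmin; apply/asboolP; split=> //; exists z'.
    by rewrite leqNgt mn.
  split=> // [y|y j kj z'y].
    case=> [<-//|[n1 [z1 [h f1 _]]]|[z1 [m1 [z1' [_ _ t1 t2]]]]].
      by have [e _] := first_uniq fx f1; rewrite e ltnn in h.
    by have [? ?] := top_uniq tx t1; subst; case: t2.
  apply: (piece_eqv (leq_trans mk kj) cz' z'x z'y); exact: first_total.
left=> y; case=> [//|[n1 [z1 [h f1 _]]]|[z1 [m1 [z1' [_ _ t1 t2]]]]].
  by have [e _] := first_uniq fx f1; rewrite e ltnn in h.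
by case: notop; exists m1, z1'.
Qed.

Lemma eqv_bounded j x : exists n z, forall y, eqv j x y ->
  y = x \/ anorm n (y - z) <= (radius n j + growth n)%N%:Z.
Proof.
have [n [z fx]] := first_total j x; exists n, z => y.
case=> [->|[n1 [z1 [h f1 f2]]]|[z1 [m1 [z1' [f1 f2 _ _]]]]]; first by left.
  by right; have [? ?] := first_uniq fx f1; subst; case: f2 => _ _ /piece_radius.
by right; have [? ?] := first_uniq fx f1; subst; case: f2 => _ _ /piece_radius.
Qed.

End Levels.

End Pieces.

(** * Pieces are discs *)

Section Connectivity.
Implicit Types (p q u v w z : Z2) (S V U : set Z2) (c : nat -> set Z2).

(** Reachability by unit steps inside [S], encoded impredicatively: arguments along paths become
    choices of [C]. *)
Definition linked S u v : Prop := forall C : set Z2, C u ->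
  (forall a b, S a -> S b -> l1 (a - b) <= 1 -> C a -> C b) -> C v.

Definition lattice_connected S : Prop := forall u v, S u -> S v -> linked S u v.

Lemma linked_refl S u : linked S u u. Proof. by move=> C. Qed.

Lemma linked_trans S u v w : linked S u v -> linked S v w -> linked S u w.
Proof. by move=> uv vw C Cu CS; apply: vw => //; apply: uv. Qed.

Lemma linked_step S u v : S u -> S v -> l1 (u - v) <= 1 -> linked S u v.
Proof. by move=> Su Sv uv C Cu /(_ u v); apply. Qed.

Lemma linked_sym S u v : linked S u v -> linked S v u.
Proof.
move=> /(_ [set w | linked S w u]); apply; first exact: linked_refl.
move=> a b Sa Sb ab; apply: linked_trans; apply: linked_step => //.
by rewrite l1C.
Qed.

Lemma linked_sub S V u v : S `<=` V -> linked S u v -> linked V u v.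
Proof. by move=> SV uv C Cu CV; apply: uv => // a b /SV Va /SV Vb; apply: CV. Qed.

Lemma aball_connected m z r : lattice_connected (aball m z r).
Proof.
suff cen u : aball m z r u -> linked (aball m z r) u z.
  by move=> u v /cen uz /cen vz; apply: linked_trans uz (linked_sym vz).
have [n] := ubnP (absz (l1 (u - z))); elim: n u => // n IH u un ru.
have t1 : 1 <= (2 ^ m)%N%:Z by have := expn_gt0 2 m; lia.
case: (ltrgtP u.1 z.1) => h1.
- apply: (@linked_trans _ _ (u.1 + 1, u.2)); last first.
    apply: IH; first by move: un; rewrite /l1 /=; lia.
    by move: ru; rewrite /aball /anorm /=; lia.
  apply: linked_step => //; last by rewrite /l1 /=; lia.
  by move: ru; rewrite /aball /anorm /=; lia.
- apply: (@linked_trans _ _ (u.1 - 1, u.2)); last first.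
    apply: IH; first by move: un; rewrite /l1 /=; lia.
    by move: ru; rewrite /aball /anorm /=; lia.
  apply: linked_step => //; last by rewrite /l1 /=; lia.
  by move: ru; rewrite /aball /anorm /=; lia.
case: (ltrgtP u.2 z.2) => h2.
- have st : aball m z r (u.1, u.2 + 1).
    by move: ru t1; rewrite /aball /anorm /=; move: (Posz (2 ^ m)) => t; nia.
  apply: (@linked_trans _ _ (u.1, u.2 + 1)); last first.
    by apply: IH => //; move: un; rewrite /l1 /=; lia.
  by apply: linked_step => //; rewrite /l1 /=; lia.
- have st : aball m z r (u.1, u.2 - 1).
    by move: ru t1; rewrite /aball /anorm /=; move: (Posz (2 ^ m)) => t; nia.
  apply: (@linked_trans _ _ (u.1, u.2 - 1)); last first.
    by apply: IH => //; move: un; rewrite /l1 /=; lia.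
  by apply: linked_step => //; rewrite /l1 /=; lia.
have -> : u = z by rewrite (surjective_pairing u) (surjective_pairing z) h1 h2.
exact: linked_refl.
Qed.

Lemma absorb_connected c m U : lattice_connected U -> lattice_connected (absorb c m U).
Proof.
move=> cU; have UA : U `<=` absorb c m U by left.
suff reach v : absorb c m U v -> exists2 u, U u & linked (absorb c m U) v u.
  move=> v w /reach[u Uu vu] /reach[u' Uu' wu'].
  apply: linked_trans vu (linked_trans _ (linked_sym wu')).
  exact: linked_sub UA (cU _ _ Uu Uu').
case=> [Uv|[z tz zv]]; first by exists v => //; exact: linked_refl.
have [cz [u [Uu zu]]] := tz; exists u => //.
by apply: linked_sub (aball_connected zv zu) => w zw; right; exists z.
Qed.

Lemma column_linked m V (x y y' : int) : cone_convex m V -> V (x, y) -> V (x, y') ->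
  linked V (x, y) (x, y').
Proof.
move=> cV; wlog yy' : y y' / y <= y'.
  move=> H h h'; case: (lerP y y') => yy'; first exact: H.
  by apply: linked_sym; apply: H => //; apply: ltW.
move=> Vy Vy'.
have [n] := ubnP (absz (y' - y)); elim: n y yy' Vy => // n IH y yy' Vy yn.
case: (ltrgtP y y') yy' => // [yy' _|-> _]; last exact: linked_refl.
have Vy1 : V (x, y + 1).
  apply: cV; exists (x, y'), (x, y); split=> //; rewrite /cone_le /= subrr normr0.
    by rewrite addrC addKr mulr1.
  by rewrite mulr_ge0 // subr_ge0; lia.
apply: (@linked_trans _ _ (x, y + 1)).
  by apply: linked_step => //; rewrite /l1 /=; lia.
by apply: IH => //; lia.
Qed.

(** Discrete intermediate value property: a unit step changes the abscissa by at most 1. *)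
Lemma linked_column V p q (x : int) : linked V p q -> V p -> V q -> p.1 <= x -> x <= q.1 ->
  exists2 r, V r & r.1 = x.
Proof.
move=> pq Vp Vq px xq; apply: contrapT => nr.
have nx r : V r -> r.1 <> x by move=> Vr rx; apply: nr; exists r.
have : q.1 < x.
  apply: (pq [set r | r.1 < x]) => /=.
    by have := nx _ Vp; lia.
  by move=> a b Va Vb; have := nx _ Va; have := nx _ Vb; rewrite /l1 /=; lia.
by lia.
Qed.

(** If [p] and [q] lie on both sides of the column of [u], then [V] meets that column, and a
    vertical walk in the hull reaches [V]. Otherwise [u] can move horizontally towards both while
    staying between them. *)
Lemma cone_hull_connected m V : lattice_connected V -> lattice_connected (cone_hull m V).
Proof.
move=> cV; have VH := @sub_cone_hull m V; have cH := @cone_hull_convex m V.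
suff reach u : cone_hull m V u -> exists2 v, V v & linked (cone_hull m V) u v.
  move=> u u' /reach[v Vv uv] /reach[v' Vv' uv'].
  apply: linked_trans uv (linked_trans _ (linked_sym uv')).
  exact: linked_sub VH (cV _ _ Vv Vv').
move=> [p [q [Vp Vq qu up]]].
have [n] := ubnP (absz (p.1 - u.1)); elim: n u qu up => // n IH u qu up un.
have Hu : cone_hull m V u by exists p, q.
have colu r : V r -> r.1 = u.1 -> exists2 v, V v & linked (cone_hull m V) u v.
  move=> Vr ru; exists r => //; rewrite (surjective_pairing u) (surjective_pairing r) ru.
  apply: (column_linked cH); first by rewrite -surjective_pairing.
  by rewrite -ru -surjective_pairing; apply: VH.
case: (lerP p.1 u.1) => pu; case: (lerP q.1 u.1) => qu'.
- case: (ltrgtP p.1 u.1) pu => // [pu _|/(colu _ Vp)//].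
  case: (ltrgtP q.1 u.1) qu' => // [qu' _|/(colu _ Vq)//].
  have qw : cone_le m q (u.1 - 1, u.2).
    by move: qu; rewrite /cone_le /=; move: (Posz (2 ^ m)) => t; lia.
  have wp : cone_le m (u.1 - 1, u.2) p.
    by move: up; rewrite /cone_le /=; move: (Posz (2 ^ m)) => t; lia.
  have [|v Vv uv] := IH _ qw wp; first by move: un; rewrite /=; lia.
  exists v => //; apply: linked_trans uv; apply: linked_step => //; last by rewrite /l1 /=; lia.
  by exists p, q.
- have [r Vr rx] := linked_column (cV _ _ Vp Vq) Vp Vq pu (ltW qu').
  exact: colu Vr rx.
- have [r Vr rx] := linked_column (cV _ _ Vq Vp) Vq Vp qu' (ltW pu).
  exact: colu Vr rx.
have qw : cone_le m q (u.1 + 1, u.2).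
  by move: qu; rewrite /cone_le /=; move: (Posz (2 ^ m)) => t; lia.
have wp : cone_le m (u.1 + 1, u.2) p.
  by move: up; rewrite /cone_le /=; move: (Posz (2 ^ m)) => t; lia.
have [|v Vv uv] := IH _ qw wp; first by move: un; rewrite /=; lia.
exists v => //; apply: linked_trans uv; apply: linked_step => //; last by rewrite /l1 /=; lia.
by exists p, q.
Qed.

Lemma grow_connected c n U : lattice_connected U -> lattice_connected (grow c n U).
Proof.
elim: n U => [|n IH] U cU //=; apply: IH.
exact: cone_hull_connected (absorb_connected cU).
Qed.

Lemma piece_connected c n j z : lattice_connected (piece c n j z).
Proof. exact: grow_connected (@aball_connected _ _ _). Qed.

Lemma piece_convex c n j z : cone_convex 0 (piece c n j z).
Proof. exact: grow_convex (@aball_convex _ _ _). Qed.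

Lemma int_bounded_min (P : int -> Prop) (M : nat) :
  (exists y, P y) -> (forall y, P y -> `|y| <= M%:Z) ->
  exists2 y, P y & forall y', P y' -> y <= y'.
Proof.
move=> [y0 Py0] PM.
pose Q n := `[< P (n%:Z - M%:Z) >].
have Q0 : exists n, Q n.
  exists (absz (y0 + M%:Z)); apply/asboolP.
  have -> : (absz (y0 + M%:Z))%:Z - M%:Z = y0 by have := PM _ Py0; lia.
  by [].
case: (ex_minnP Q0) => n /asboolP Pn nmin; exists (n%:Z - M%:Z) => // y Py.
have : (n <= absz (y + M%:Z)%R)%N.
  apply: nmin; apply/asboolP.
  have -> : (absz (y + M%:Z))%:Z - M%:Z = y by have := PM _ Py; lia.
  by [].
by have := PM _ Py; lia.
Qed.

Lemma int_bounded_max (P : int -> Prop) (M : nat) :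
  (exists y, P y) -> (forall y, P y -> `|y| <= M%:Z) ->
  exists2 y, P y & forall y', P y' -> y' <= y.
Proof.
move=> [y0 Py0] PM.
have [||y Py ymin] := @int_bounded_min (fun y => P (- y)) M.
- by exists (- y0); rewrite opprK.
- by move=> y /PM; rewrite normrN.
by exists (- y) => // y' Py'; rewrite lerNr; apply: ymin; rewrite opprK.
Qed.

Lemma column_convex m S (x y y1 y2 : int) : cone_convex m S ->
  S (x, y1) -> S (x, y2) -> y1 <= y <= y2 -> S (x, y).
Proof.
move=> cS S1 S2 yy; apply: cS; exists (x, y2), (x, y1).
by split=> //; rewrite /cone_le /= subrr normr0 mulr_ge0 //; lia.
Qed.

(** * Unions of unit squares *)

Section Cells.
Variable R : realType.

(** Convexity makes each column an interval, and connectedness makes consecutive columns share an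
    ordinate, so [strips_disk] applies. *)
Lemma cells_disk m S (M : nat) : S !=set0 -> (forall u, S u -> l1 u <= M%:Z) ->
  lattice_connected S -> cone_convex m S ->
  homeomorphic (\bigcup_(g in S) @unit_square R g) (@unit_disk R).
Proof.
move=> [u0 Su0] bS cS vS.
have bx x : (exists y, S (x, y)) -> `|x| <= M%:Z.
  by move=> [y /bS]; rewrite /l1 /=; lia.
have by' x y : S (x, y) -> `|y| <= M%:Z by move=> /bS; rewrite /l1 /=; lia.
have ex0 : exists x y, S (x, y) by exists u0.1, u0.2; rewrite -surjective_pairing.
have [a [ya Sa] amin] := int_bounded_min ex0 bx.
have [b [yb Sb] bmax] := int_bounded_max ex0 bx.
have ab : a <= b by apply: bmax; exists ya.
have exx x : a <= x <= b -> exists y, S (x, y).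
  move=> /andP[ax xb]; have [r Sr rx] := linked_column (cS _ _ Sa Sb) Sa Sb ax xb.
  by exists r.2; rewrite -rx -surjective_pairing.
pose k := absz (b - a).
have kE : b = a + k%:Z by rewrite /k; lia.
have col i : exists lh : int * int, (i <= k)%N ->
    [/\ S (a + i%:Z, lh.1), S (a + i%:Z, lh.2) &
      forall y, S (a + i%:Z, y) -> lh.1 <= y <= lh.2].
  case: (leqP i k) => ik; last by exists (0, 0).
  have exi : exists y, S (a + i%:Z, y) by apply: exx; lia.
  have [lo Slo lomin] := int_bounded_min exi (by' _).
  have [hi Shi himax] := int_bounded_max exi (by' _).
  by exists (lo, hi) => _; split=> // y Sy; rewrite lomin ?himax.
have [lh lhP] := choice col.
pose lo i : R := (lh i).1%:~R; pose hi i : R := (lh i).2%:~R + 1.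
have lh1 i : (i <= k)%N -> lo i < hi i.
  move=> /lhP[S1 S2 /(_ _ S1) /andP[_ h]]; rewrite /lo /hi.
  by rewrite -(@intrD1 R) ltr_int; lia.
have ov i : (i < k)%N -> Num.max (lo i) (lo i.+1) < Num.min (hi i) (hi i.+1).
  move=> ik.
  (* Otherwise no unit step would cross from column [a + i] to the next, and the leftmost column
     could not be linked to the rightmost. *)
  have [y Sy Sy'] : exists2 y, S (a + i%:Z, y) & S (a + i.+1%:Z, y).
    apply: contrapT => no.
    have : b <= a + i%:Z; last by lia.
    apply: (cS _ _ Sa Sb [set r | r.1 <= a + i%:Z]) => /=; first lia.
    move=> p q Sp Sq pq pa; rewrite leNgt; apply/negP => aq; apply: no.
    exists p.2.
      have -> : a + i%:Z = p.1 by move: pq; rewrite /l1 /=; lia.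
      by rewrite -surjective_pairing.
    have -> : a + i.+1%:Z = q.1 by move: pq; rewrite /l1 /=; lia.
    have -> : p.2 = q.2 by move: pq; rewrite /l1 /=; lia.
    by rewrite -surjective_pairing.
  have [_ _ /(_ _ Sy) /andP[h1 h2]] := lhP _ (ltnW ik).
  have [_ _ /(_ _ Sy') /andP[h3 h4]] := lhP _ ik.
  by rewrite gt_max !lt_min /lo /hi -!(@intrD1 R) !ltr_int; lia.
suff -> : \bigcup_(g in S) @unit_square R g = strips a%:~R lo hi k.+1 by exact: strips_disk.
have stripsP n (z : R * R) : strips a%:~R lo hi n z <-> exists2 i, (i < n)%N & strip a%:~R lo hi i z.
  elim: n => [|n IH] /=; first by split=> // -[].
  split=> [[/IH[i /ltnW]|]|[i]]; first by exists i.
    by exists n.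
  rewrite ltnS leq_eqVlt => /predU1P[->|]; first by right.
  by move=> *; left; apply/IH; exists i.
apply/seteqP; split=> z.
  move=> [g Sg [/andP[h1 h2] /andP[h3 h4]]]; apply/stripsP.
  have ga : a <= g.1 by apply: amin; exists g.2; rewrite -surjective_pairing.
  have gb : g.1 <= b by apply: bmax; exists g.2; rewrite -surjective_pairing.
  have ik : (absz (g.1 - a)%R < k.+1)%N by rewrite /k; lia.
  exists (absz (g.1 - a)) => //.
  have gE : g.1 = a + (absz (g.1 - a))%:Z by lia.
  have [_ _ /(_ g.2)] := lhP _ ik; rewrite -gE -surjective_pairing => /(_ Sg) /andP[g1 g2].
  have e : a%:~R + (absz (g.1 - a))%:R = g.1%:~R :> R by rewrite {2}gE intrD -pmulrn.
  rewrite /strip e; split; first by apply/andP.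
  rewrite /lo /hi; apply/andP; split.
    by apply: le_trans h3; rewrite ler_int.
  by apply: le_trans h4 _; rewrite lerD2r ler_int.
move=> /stripsP[i ik [/andP[h1 h2] /andP[h3 h4]]].
have [S1 S2 _] := lhP _ ik.
(* On the top edge of a column the floor is one too large, hence the minimum. *)
pose y := Num.min (Num.floor z.2) (lh i).2.
have fl : (Num.floor z.2)%:~R <= z.2 by exact: floor_le.
have fl' : z.2 < (Num.floor z.2)%:~R + 1 by rewrite -intrD1 floorD1_gt.
exists (a + i%:Z, y).
  apply: (column_convex vS S1 S2); rewrite /y le_min ge_min lexx orbT andbT.
  have /andP[-> _] : (lh i).1 <= (lh i).2 <= (lh i).2 by have [_ _] := lhP _ ik; apply.
  by rewrite andbT floor_ge_int.
have e : (a + i%:Z)%:~R = a%:~R + i%:R :> R by rewrite intrD -pmulrn.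
split; rewrite /= ?e; first by apply/andP.
rewrite /y; case: (leP (Num.floor z.2) (lh i).2) => hh; apply/andP; split=> //.
  exact: ltW.
by apply: le_trans fl; rewrite ler_int ltW.
Qed.

End Cells.

End Connectivity.

(** * Marker points *)

Section Markers.
Implicit Types (g h : Z2) (x : shift_space).

Lemma zactM g h x : zact g (zact h x) = zact (h + g) x.
Proof. by apply/funext => k; rewrite /zact addrA. Qed.

Lemma zact0 x : zact 0 x = x.
Proof. by apply/funext => k; rewrite /zact add0r. Qed.

Lemma free_zact g x : free_part x -> free_part (zact g x).
Proof.
move=> fx h h0; rewrite zactM => e; apply: (fx h h0).
by have := congr1 (zact (- g)) e; rewrite !zactM (addrC g) addrK subrr zact0.
Qed.

Lemma free_inj x : free_part x -> injective (fun g => zact g x).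
Proof.
move=> fx g h /= e; apply/eqP; rewrite -subr_eq0; apply/negPn/negP => /(fx _); apply.
by have := congr1 (zact (- h)) e; rewrite !zactM subrr zact0.
Qed.

(** * Maximal discrete sets *)

Section Greedy.
Variable F : seq Z2.

(* A window pattern that no point shares with its translates by [F]. *)
Definition breaks (s : seq (Z2 * bool)) x : Prop := forall i, (i < size F)%N ->
  let u := nth (0, false) s i in x u.1 = u.2 /\ x (nth 0 F i + u.1) <> u.2.

Definition breaks_code (k : nat) x : Prop :=
  if unpickle k is Some s then breaks s x else False.

(** Patterns are treated one after the other: a point recognised by the current one enters unless an
    [F]-translate is already in. *)
Fixpoint greedy (k : nat) x : Prop :=
  if k is k'.+1 then
    greedy k' x \/ breaks_code k' x /\
      forall i, (i < size F)%N -> ~ greedy k' (zact (nth 0 F i) x)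
  else False.

Definition marker x : Prop := exists k, greedy k x.

Lemma breaks_code_moves k g x : g \in F -> breaks_code k x -> ~ breaks_code k (zact g x).
Proof.
rewrite /breaks_code; case: unpickle => // s gF; rewrite -(nth_index 0 gF).
move: (gF); rewrite -index_mem => iF bx /(_ _ iF) [/= bgx _].
by have [_] := bx _ iF; apply.
Qed.

(** Freeness gives, for each [g] in [F], a coordinate where [x] and its translate differ; the
    pattern records these coordinates. *)
Lemma breaks_exist x : free_part x -> 0 \notin F -> exists k, breaks_code k x.
Proof.
move=> fx F0; have sep g : exists h, g \in F -> x (g + h) <> x h.
  have [gF|] := boolP (g \in F); last by exists 0.
  have g0 : g != 0 by apply: contra F0 => /eqP <-.
  apply: contrapT => nh; apply: (fx _ g0); apply/funext => h.
  by apply: contrapT => gh; apply: nh; exists h.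
have [h hP] := choice sep.
exists (pickle [seq (h g, x (h g)) | g <- F]); rewrite /breaks_code pickleK => i iF.
by rewrite (nth_map 0) //=; split=> //; apply: hP; apply: mem_nth.
Qed.

Lemma greedy_mono k k' x : (k <= k')%N -> greedy k x -> greedy k' x.
Proof.
move=> /subnKC <-; elim: (k' - k)%N => [|m IH]; first by rewrite addn0.
by rewrite addnS => /IH h; left.
Qed.

Lemma greedy_first k x : greedy k x -> exists2 m, ~ greedy m x & greedy m.+1 x.
Proof.
elim: k => // k IH gx; have [/IH //|ngx] := pselect (greedy k x).
by exists k.
Qed.

(** Of two points entering at different stages, the later is blocked by the earlier, symmetry of [F]
    covering both orders. At equal stages they share a pattern, against [breaks_code_moves]. *)
Lemma marker_discrete g x : (forall g, g \in F -> - g \in F) ->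
  g \in F -> marker x -> ~ marker (zact g x).
Proof.
move=> symF gF [k /greedy_first[m nm gm]] [k' /greedy_first[m' nm' gm']].
case: gm => // -[bm fm]; case: gm' => // -[bm' fm'].
have nth_ex h : h \in F -> exists2 i, (i < size F)%N & nth 0 F i = h.
  by move=> hF; exists (index h F); rewrite ?index_mem // nth_index.
case: (ltngtP m m') => mm'.
- have [i iF ig] := nth_ex _ (symF _ gF).
  apply: (fm' _ iF); rewrite ig zactM subrr zact0.
  by apply: (greedy_mono mm'); right.
- have [i iF ig] := nth_ex _ gF.
  by apply: (fm _ iF); rewrite ig; apply: (greedy_mono mm'); right.
by subst m'; exact: breaks_code_moves gF bm bm'.
Qed.

Lemma marker_maximal x : free_part x -> 0 \notin F ->
  marker x \/ exists2 g, g \in F & marker (zact g x).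
Proof.
move=> fx F0; have [k bk] := breaks_exist fx F0.
have [[i [iF gi]]|no] := pselect (exists i, (i < size F)%N /\ greedy k (zact (nth 0 F i) x)).
  by right; exists (nth 0 F i); [exact: mem_nth|exists k].
by left; exists k.+1; right; split=> // i iF gi; apply: no; exists i.
Qed.

End Greedy.

(** * Nets, recurring translates and configurations *)

Definition int_range (r : nat) : seq int := [seq i%:Z - r%:Z | i <- iota 0 (2 * r).+1].

Lemma mem_int_range r (a : int) : (a \in int_range r) = (`|a| <= r%:Z).
Proof.
apply/mapP/idP => [[i]|h]; first by rewrite mem_iota => *; lia.
by exists (absz (a + r%:Z)); [rewrite mem_iota; lia|lia].
Qed.

Definition box (r : nat) : seq Z2 := [seq (a, b) | a <- int_range r, b <- int_range r].

Lemma mem_box r g : (g \in box r) = (`|g.1| <= r%:Z) && (`|g.2| <= r%:Z).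
Proof.
apply/allpairsP/andP => [[[a b] [/=]]|[h1 h2]].
  by rewrite !mem_int_range => ? ? ->.
by exists g; rewrite !mem_int_range -surjective_pairing.
Qed.

Definition punctured_ball (n r : nat) : seq Z2 :=
  [seq g <- box r | (g != 0) && (anorm n g <= r%:Z)].

Lemma mem_punctured_ball n r g :
  (g \in punctured_ball n r) = (g != 0) && (anorm n g <= r%:Z).
Proof.
rewrite mem_filter; apply/andP/idP => [[]//|h]; split=> //; rewrite mem_box.
by move/andP: h => [_ h]; have := le1_anorm n g; rewrite /=; lia.
Qed.

Definition net (n : nat) : shift_space -> Prop := marker (punctured_ball n (50 * width n)).

(* The translates by the points of a coarse grid: together they meet every ball
   of radius [2 * width n], and their number does not depend on [n]. *)
Definition net_shift (n : nat) (t : Z2) x : Prop :=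
  net n (zact (t.1 * (width n)%:Z, t.2 * (n.+1 * gap n)%N%:Z) x).

Lemma gap_gt0 n : (0 < gap n)%N.
Proof. by rewrite gapE; have := expn_gt0 4 n; lia. Qed.

Lemma width_gt0 n : (0 < width n)%N.
Proof. by rewrite /width !muln_gt0 expn_gt0 gap_gt0. Qed.

Lemma net_shift_discrete n t g x : g != 0 -> anorm n g <= (50 * width n)%N%:Z ->
  net_shift n t x -> ~ net_shift n t (zact g x).
Proof.
move=> g0 gw nx; rewrite /net_shift zactM addrC -zactM.
apply: marker_discrete nx; last by rewrite mem_punctured_ball g0.
move=> h; rewrite !mem_punctured_ball oppr_eq0 => /andP[-> ] /=.
by have := anormC n 0 h; rewrite sub0r subr0 => ->.
Qed.

Lemma net_near n x : free_part x ->
  exists2 g, anorm n g <= (50 * width n)%N%:Z & net n (zact g x).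
Proof.
move=> fx; have [|nx|[g]] := marker_maximal (F := punctured_ball n (50 * width n)) fx.
- by rewrite mem_punctured_ball eqxx.
- by exists 0; rewrite ?zact0 // /anorm /= mulr0 normr0.
by rewrite mem_punctured_ball => /andP[_ ?]; exists g.
Qed.

(** Divide the coordinates of a nearby net point by the grid steps: the quotients select the
    translate, and each remainder costs less than [width n]. *)
Lemma net_shift_near n x : free_part x -> exists2 t, t \in box 50 &
  exists2 g, anorm n g <= (2 * width n)%N%:Z & net_shift n t (zact g x).
Proof.
move=> /(@net_near n) [[a b]]; set v := (n.+1 * gap n)%N.
have v0 : 0 < v%:Z by rewrite ltz_nat muln_gt0 gap_gt0.
have w0 : 0 < (width n)%:Z by rewrite ltz_nat width_gt0.
have wv : (width n)%:Z = (2 ^ n)%N%:Z * v%:Z by rewrite -PoszM.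
have t0 : 0 < (2 ^ n)%N%:Z by rewrite ltz_nat expn_gt0.
rewrite /anorm /= PoszM => h nx.
exists ((a %/ width n)%Z, (b %/ v)%Z).
  rewrite mem_box /=.
  have ha : `|a| <= 50 * (width n)%:Z by lia.
  have hb : `|b| <= 50 * v%:Z.
    have : (2 ^ n)%N%:Z * `|b| <= (2 ^ n)%N%:Z * (50 * v%:Z).
      rewrite mulrCA -wv; have e : `|(2 ^ n)%N%:Z * b| = (2 ^ n)%N%:Z * `|b|.
        by rewrite normrM ger0_norm // ltW.
      by move: h; rewrite e; have := normr_ge0 a; move: (_ * `|b|); lia.
    by rewrite ler_pM2l.
  have quo (c d : int) : 0 < d -> `|c| <= 50 * d -> `|(c %/ d)%Z| <= 50.
    move=> d0 cd; have := divz_eq c d; have := modz_ge0 c (lt0r_neq0 d0).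
    have := ltz_pmod c d0; move: (c %/ d)%Z (c %% d)%Z => q r; nia.
  by rewrite !quo.
exists ((a %% width n)%Z, (b %% v)%Z); last first.
  have e : (a, b) = ((a %% width n)%Z, (b %% v)%Z) +
      ((a %/ width n)%Z * (width n)%:Z, (b %/ v)%Z * v%:Z) :> Z2.
    by congr pair; rewrite /= addrC -divz_eq.
  by rewrite /net_shift zactM -e.
have := modz_ge0 a (lt0r_neq0 w0); have := ltz_pmod a w0.
have := modz_ge0 b (lt0r_neq0 v0); have := ltz_pmod b v0.
rewrite /anorm /= normrM; move: (a %% _)%Z (b %% _)%Z => ra rb b1 b2 a1 a2.
rewrite (ger0_norm a2) (ger0_norm b2) ger0_norm ?ltW //.
have : (2 ^ n)%N%:Z * rb < (2 ^ n)%N%:Z * v%:Z by rewrite ltr_pM2l.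
by rewrite -wv; lia.
Qed.

Definition grid (p : nat) : Z2 := nth 0 (box 50) p.

(** The choice of [h] makes this a property of the orbit. *)
Definition recurs (p : nat) x : Prop := exists h, forall n0, exists n, (n0 <= n)%N /\
  exists g, anorm n g <= (2 * width n)%N%:Z /\ net_shift n (grid p) (zact g (zact h x)).

Lemma recurs_zact p g x : recurs p (zact g x) <-> recurs p x.
Proof.
split=> -[h H]; first by exists (g + h) => n0; have := H n0; rewrite -zactM.
by exists (h - g) => n0; have := H n0; rewrite !zactM addrC subrK.
Qed.

(** Pigeonhole: if each translate stayed away from [x] from some level on, none would be near [x] at
    the largest of these levels. *)
Lemma recurs_exists x : free_part x -> exists p, (p < size (box 50))%N /\ recurs p x.
Proof.
move=> fx; apply: contrapT => no.
have late p : exists n0, (p < size (box 50))%N -> forall n, (n0 <= n)%N ->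
    forall g, anorm n g <= (2 * width n)%N%:Z -> ~ net_shift n (grid p) (zact g x).
  have [ps|] := ltnP p (size (box 50)); last by exists 0%N.
  apply: contrapT => nn0; apply: no; exists p; split=> //; exists 0 => n0.
  apply: contrapT => nn; apply: nn0; exists n0 => _ n n0n g gw nx.
  by apply: nn; exists n; split=> //; exists g; rewrite zact0.
have [N NP] := choice late.
pose M := (\max_(p < size (box 50)) N p)%N.
have [t tb [g gw nx]] := net_shift_near M fx.
have tp : (index t (box 50) < size (box 50))%N by rewrite index_mem.
apply: (NP _ tp M _ g gw); last by rewrite /grid nth_index.
exact: (leq_bigmax (Ordinal tp)).
Qed.

(** The least recurring index depends only on the orbit, so a single translate serves the whole
    orbit. *)
Definition marked (n : nat) x : Prop := exists p, [/\ (p < size (box 50))%N, recurs p x,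
  (forall q, (q < p)%N -> ~ recurs q x) & net_shift n (grid p) x].

Definition conf x (n : nat) : set Z2 := [set g | marked n (zact g x)].

Lemma conf_sparse x : sparse (conf x).
Proof.
move=> n z z' [p [ps rp mp nz]] [p' [ps' rp' mp' nz']] zw.
have pp : p' = p.
  case: (ltngtP p p') => // h; exfalso.
    by apply: (mp' _ h); apply/recurs_zact; move/recurs_zact: rp.
  by apply: (mp _ h); apply/recurs_zact; move/recurs_zact: rp'.
subst p'; apply/eqP; rewrite -subr_eq0; apply/negPn/negP => zz.
apply: (net_shift_discrete zz zw nz).
by rewrite zactM addrC subrK.
Qed.

Lemma conf_covering x : free_part x -> covering (conf x).
Proof.
move=> fx y j; have [p0 Hp0] := recurs_exists fx.
have ex : exists p, `[< (p < size (box 50))%N /\ recurs p x >] by exists p0; apply/asboolP.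
case: (ex_minnP ex) => p /asboolP[ps rp] pmin.
(* For [n] beyond the distance from [y] to [h], [anorm n (y - h) <= 2 ^ n * n <= width n]; adding
   the [2 * width n] of [recurs] gives the covering distance. *)
have [h H] := rp; have [n [nn [g [gw nx]]]] := H (maxn j (absz (l1 (y - h)))).
exists n, (h + g); split; first by move: nn; rewrite geq_max => /andP[].
  rewrite /conf /=; exists p; split=> //; first exact/recurs_zact.
    move=> q qp /recurs_zact rq.
    have : (p <= q)%N by apply: pmin; apply/asboolP; split=> //; exact: ltn_trans ps.
    by rewrite leqNgt qp.
  by rewrite -zactM.
have yh : anorm n (y - h) <= (2 ^ n * n)%N%:Z.
  by apply: anorm_l1; move: nn; rewrite geq_max => /andP[_]; rewrite /l1; lia.
have : (2 ^ n * n <= width n)%N.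
  by rewrite /width leq_mul2l; have := gap_gt0 n; nia.
have := anorm_sub n y h (h + g).
have -> : h - (h + g) = 0 - g by rewrite opprD addrA subrr.
by rewrite (anormC n 0 g) subr0; lia.
Qed.

End Markers.

(** * Borel measurability *)

Section BorelPredicates.
Variable T : topologicalType.
Implicit Types (f : T -> shift_space) (phi psi : T -> Prop).

Definition bpred phi : Prop := borel [set t | phi t].

Lemma bpred_iff phi psi : (forall t, phi t <-> psi t) -> bpred phi -> bpred psi.
Proof.
by move=> e; rewrite /bpred (_ : [set t | phi t] = [set t | psi t]) //; apply/seteqP; split=> t /e.
Qed.

Lemma bpred_not phi : bpred phi -> bpred (fun t => ~ phi t).
Proof.
move=> bphi; rewrite /bpred /borel (_ : [set t | ~ phi t] = setT `\` [set t | phi t]).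
  exact: sigma_algebraCD.
by apply/seteqP; split=> t; [split|case].
Qed.

Lemma bpred_ex (I : countType) (phi : I -> T -> Prop) :
  (forall i, bpred (phi i)) -> bpred (fun t => exists i, phi i t).
Proof.
move=> bphi; have := @sigma_algebra_bigcup _ setT (@open T)
  (fun n => if unpickle n is Some i then [set t | phi i t] else set0).
rewrite /bpred /borel => bU; rewrite (_ : [set t | exists i, phi i t] =
  \bigcup_n (if unpickle n is Some i then [set t | phi i t] else set0)).
  by apply: bU => n; case: unpickle => [i|]; [exact: bphi|exact: sigma_algebra0].
apply/seteqP; split=> t.
  by move=> [i it]; exists (pickle i) => //; rewrite pickleK.
by move=> [n _]; case: unpickle => // i it; exists i.
Qed.

Lemma bpred_all (I : countType) (phi : I -> T -> Prop) :
  (forall i, bpred (phi i)) -> bpred (fun t => forall i, phi i t).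
Proof.
move=> bphi; apply: (@bpred_iff (fun t => ~ exists i, ~ phi i t)).
  by move=> t; split=> [nex i|h [i]//]; apply: contrapT => ni; apply: nex; exists i.
by apply: bpred_not; apply: bpred_ex => i; apply: bpred_not.
Qed.

Lemma bpred_and phi psi : bpred phi -> bpred psi -> bpred (fun t => phi t /\ psi t).
Proof.
move=> bphi bpsi; apply: (@bpred_iff (fun t => forall b : bool, if b then phi t else psi t)).
  by move=> t; split=> [h|[? ?] []//]; split; [exact: (h true)|exact: (h false)].
by apply: bpred_all => -[].
Qed.

Lemma bpred_or phi psi : bpred phi -> bpred psi -> bpred (fun t => phi t \/ psi t).
Proof.
move=> bphi bpsi; apply: (@bpred_iff (fun t => exists b : bool, if b then phi t else psi t)).
  by move=> t; split=> [[[]]|[]]; [left|right|exists true|exists false].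
by apply: bpred_ex => -[].
Qed.

Lemma bpred_const (P : Prop) : bpred (fun _ => P).
Proof.
have b0 : bpred (fun _ => False) by exact: sigma_algebra0.
have [h|h] := pselect P.
  by apply: bpred_iff (bpred_not b0) => t; split=> // _ [].
by apply: bpred_iff b0.
Qed.

Lemma bpred_imp phi psi : bpred phi -> bpred psi -> bpred (fun t => phi t -> psi t).
Proof.
move=> bphi bpsi; apply: (@bpred_iff (fun t => ~ phi t \/ psi t)).
  by move=> t; split=> [[]// h /h|h]; have [/h|] := pselect (phi t); [right|left].
by apply: bpred_or => //; apply: bpred_not.
Qed.

Lemma bpred_ex2 (I : countType) (phi psi : I -> T -> Prop) :
  (forall i, bpred (phi i)) -> (forall i, bpred (psi i)) ->
  bpred (fun t => exists2 i, phi i t & psi i t).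
Proof.
move=> bphi bpsi; apply: (@bpred_iff (fun t => exists i, phi i t /\ psi i t)).
  by move=> t; split=> [[i []]|[i]]; exists i.
by apply: bpred_ex => i; apply: bpred_and.
Qed.

Lemma bpred_and3 (P Q S : T -> Prop) : bpred P -> bpred Q -> bpred S ->
  bpred (fun t => [/\ P t, Q t & S t]).
Proof.
move=> bP bQ bS; apply: (@bpred_iff (fun t => P t /\ Q t /\ S t)).
  by move=> t; split=> [[? []]|[]].
by do !apply: bpred_and.
Qed.

Lemma bpred_and4 (P Q S W : T -> Prop) : bpred P -> bpred Q -> bpred S -> bpred W ->
  bpred (fun t => [/\ P t, Q t, S t & W t]).
Proof.
move=> bP bQ bS bW; apply: (@bpred_iff (fun t => P t /\ Q t /\ S t /\ W t)).
  by move=> t; split=> [[? [? []]]|[]].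
by do !apply: bpred_and.
Qed.

Lemma bpred_or3 (P Q S : T -> Prop) : bpred P -> bpred Q -> bpred S ->
  bpred (fun t => [\/ P t, Q t | S t]).
Proof.
move=> bP bQ bS; apply: (@bpred_iff (fun t => P t \/ Q t \/ S t)).
  by move=> t; split=> [[|[]]|[]]; [constructor 1|constructor 2|constructor 3|left|right; left|right; right].
by do !apply: bpred_or.
Qed.

(** A map [f] is carried along because the recursions evaluate predicates at translates, and because
    the partitions concern both projections of a pair. *)
Definition coordinatewise f : Prop := forall h b, bpred (fun t => f t h = b).

Lemma coordinatewise_zact g f : coordinatewise f -> coordinatewise (fun t => zact g (f t)).
Proof. by move=> cf h b; exact: cf. Qed.

Lemma bpred_free f : coordinatewise f -> bpred (fun t => free_part (f t)).
Proof.
(* Equality of two coordinates goes through their common value [b], the atomic Borel predicates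
   being [f t h = b]. *)
move=> cf; apply: (@bpred_iff (fun t => forall g : Z2, g != 0 ->
    exists h : Z2, ~ exists b : bool, f t (g + h) = b /\ f t h = b)).
  move=> t; split=> H g g0.
    have [h nh] := H g g0 => e; apply: nh; exists (f t h); split=> //.
    exact: (congr1 (fun x : shift_space => x h) e).
  apply: contrapT => nh; apply: (H g g0); apply/funext => h.
  apply: contrapT => ne; apply: nh; exists h => -[b [e1 e2]]; apply: ne.
  by rewrite /zact e1 e2.
apply: bpred_all => g; apply: bpred_imp; first exact: bpred_const.
apply: bpred_ex => h; apply: bpred_not; apply: bpred_ex => b.
by apply: bpred_and; exact: cf.
Qed.

Lemma bpred_greedy F k f : coordinatewise f -> bpred (fun t => greedy F k (f t)).
Proof.
elim: k f => [|k IH] f cf /=; first exact: bpred_const.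
apply: bpred_or; first exact: IH.
apply: bpred_and.
  rewrite /breaks_code; case: unpickle => [s|]; last exact: bpred_const.
  apply: bpred_all => i; apply: bpred_imp; first exact: bpred_const.
  by apply: bpred_and; [exact: cf|apply: bpred_not; exact: cf].
apply: bpred_all => i; apply: bpred_imp; first exact: bpred_const.
by apply: bpred_not; apply: IH; exact: coordinatewise_zact.
Qed.

Lemma bpred_net_shift n p f : coordinatewise f -> bpred (fun t => net_shift n p (f t)).
Proof.
by move=> cf; apply: bpred_ex => k; apply: bpred_greedy; exact: coordinatewise_zact.
Qed.

Lemma bpred_recurs p f : coordinatewise f -> bpred (fun t => recurs p (f t)).
Proof.
move=> cf; apply: bpred_ex => h; apply: bpred_all => n0; apply: bpred_ex => n.
apply: bpred_and; first exact: bpred_const.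
apply: bpred_ex => g; apply: bpred_and; first exact: bpred_const.
by apply: bpred_net_shift; do 2!apply: coordinatewise_zact.
Qed.

Lemma bpred_conf n g f : coordinatewise f -> bpred (fun t => conf (f t) n g).
Proof.
move=> cf; have cgf := coordinatewise_zact g cf.
apply: bpred_ex => p; apply: bpred_and4; first exact: bpred_const.
- exact: bpred_recurs.
- apply: bpred_all => q; apply: bpred_imp; first exact: bpred_const.
  by apply: bpred_not; exact: bpred_recurs.
exact: bpred_net_shift.
Qed.

Lemma bpred_grow n (U : T -> set Z2) v f : coordinatewise f ->
  (forall u, bpred (fun t => U t u)) -> bpred (fun t => grow (conf (f t)) n (U t) v).
Proof.
move=> cf; elim: n U v => [|n IH] U v bU /=; first exact: bU.
apply: IH => u.
have bA w : bpred (fun t => absorb (conf (f t)) n (U t) w).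
  apply: bpred_or; first exact: bU.
  apply: bpred_ex2 => z; last exact: bpred_const.
  apply: bpred_and; first exact: bpred_conf.
  by apply: bpred_ex => r; apply: bpred_and; [exact: bU|exact: bpred_const].
apply: bpred_ex => p; apply: bpred_ex => q.
by apply: bpred_and4; [exact: bA|exact: bA|exact: bpred_const|exact: bpred_const].
Qed.

Lemma bpred_piece n j z v f : coordinatewise f ->
  bpred (fun t => piece (conf (f t)) n j z v).
Proof. by move=> cf; apply: bpred_grow => // u; exact: bpred_const. Qed.

Lemma bpred_first j n z u f : coordinatewise f ->
  bpred (fun t => first (conf (f t)) j n z u).
Proof.
move=> cf; apply: bpred_and4; first exact: bpred_const.
- exact: bpred_conf.
- exact: bpred_piece.
apply: bpred_all => m; apply: bpred_all => z'; apply: bpred_imp; first exact: bpred_const.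
apply: bpred_imp; first exact: bpred_conf.
by apply: bpred_not; exact: bpred_piece.
Qed.

Lemma bpred_top j m z u f : coordinatewise f ->
  bpred (fun t => top (conf (f t)) j m z u).
Proof.
move=> cf; apply: bpred_and4; first exact: bpred_const.
- exact: bpred_conf.
- exact: bpred_piece.
apply: bpred_all => n; apply: bpred_all => z'; apply: bpred_imp; first exact: bpred_const.
apply: bpred_imp; first exact: bpred_conf.
by apply: bpred_not; exact: bpred_piece.
Qed.

Lemma bpred_eqv j u v f : coordinatewise f -> bpred (fun t => eqv (conf (f t)) j u v).
Proof.
move=> cf; apply: bpred_or3; first exact: bpred_const.
- apply: bpred_ex => n; apply: bpred_ex => z.
  by apply: bpred_and3; [exact: bpred_const|exact: bpred_first|exact: bpred_first].
apply: bpred_ex => z; apply: bpred_ex => m; apply: bpred_ex => z'.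
by apply: bpred_and4; [exact: bpred_first|exact: bpred_first|exact: bpred_top|exact: bpred_top].
Qed.

End BorelPredicates.

Lemma open_coordinate (T : topologicalType) (f : T -> shift_space) (h : Z2) (b : bool) :
  continuous f -> open [set t | f t h = b].
Proof.
move=> cf; have ch : continuous (fun t => f t h).
  move=> t; apply: (@continuous_comp _ _ _ f (fun x : shift_space => x h)); first exact: cf.
  exact: (@proj_continuous _ (fun _ : Z2 => bool) h).
have -> : [set t | f t h = b] = (fun t => f t h) @^-1` [set b] by [].
by apply: open_comp; [move=> t _; exact: ch|exact: discrete_open].
Qed.

Lemma coordinatewise_continuous (T : topologicalType) (f : T -> shift_space) :
  continuous f -> coordinatewise f.
Proof. by move=> cf h b; apply: sub_sigma_algebra; exact: open_coordinate. Qed.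

(** * The decomposition *)

Section Translation.
Variable h : Z2.
Implicit Types (u v z : Z2) (U V : set Z2) (c : nat -> set Z2).

Definition translate V : set Z2 := [set u | V (h + u)].

Definition translate_conf c : nat -> set Z2 := fun n => translate (c n).

Lemma sub_translate u v : h + u - (h + v) = u - v.
Proof. by rewrite opprD addrACA subrr add0r. Qed.

Lemma translateK u : h + (u - h) = u.
Proof. by rewrite addrC subrK. Qed.

Lemma cone_le_translate m u v : cone_le m (h + u) (h + v) <-> cone_le m u v.
Proof.
have e1 : (h + v).1 - (h + u).1 = v.1 - u.1 by rewrite /=; lia.
have e2 : (h + v).2 - (h + u).2 = v.2 - u.2 by rewrite /=; lia.
by rewrite /cone_le e1 e2.
Qed.

Lemma absorb_translate c m U :
  absorb (translate_conf c) m (translate U) = translate (absorb c m U).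
Proof.
apply/seteqP; split=> v [Uv|[z [cz [u [Uu zu]]] zv]]; [by left| |by left|].
  right; exists (h + z); last by rewrite aballE sub_translate.
  by split=> //; exists (h + u); split=> //; rewrite aballE sub_translate.
right; exists (z - h); last by rewrite aballE -sub_translate translateK.
split; first by rewrite /translate_conf /translate /= translateK.
exists (u - h); split; first by rewrite /translate /= translateK.
by rewrite aballE -sub_translate !translateK.
Qed.

Lemma cone_hull_translate m V : cone_hull m (translate V) = translate (cone_hull m V).
Proof.
apply/seteqP; split=> v [p [q [Vp Vq qv vp]]].
  by exists (h + p), (h + q); split=> //; apply/cone_le_translate.
exists (p - h), (q - h); rewrite /translate /= !translateK.
by split=> //; apply/cone_le_translate; rewrite translateK.
Qed.

Lemma grow_translate c n U :
  grow (translate_conf c) n (translate U) = translate (grow c n U).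
Proof.
elim: n U => //= n IH U.
by rewrite /step absorb_translate cone_hull_translate IH.
Qed.

Lemma piece_translate c n j z :
  piece (translate_conf c) n j z = translate (piece c n j (h + z)).
Proof.
rewrite /piece -grow_translate; congr (grow _ _ _).
by apply/seteqP; split=> u; rewrite /translate /= !aballE sub_translate.
Qed.

Lemma first_translate c j n z u :
  first (translate_conf c) j n z u <-> first c j n (h + z) (h + u).
Proof.
rewrite /first piece_translate; split=> -[? ? ? H]; split=> // m z' jm.
  by have := H m (z' - h) jm; rewrite piece_translate /translate_conf /translate /= translateK.
by rewrite piece_translate; exact: H.
Qed.

Lemma top_translate c j n z u :
  top (translate_conf c) j n z u <-> top c j n (h + z) (h + u).
Proof.
rewrite /top piece_translate; split=> -[? ? ? H]; split=> // m z' jm.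
  by have := H m (z' - h) jm; rewrite piece_translate /translate_conf /translate /= translateK.
by rewrite piece_translate; exact: H.
Qed.

Lemma eqv_translate c j u v :
  eqv (translate_conf c) j u v <-> eqv c j (h + u) (h + v).
Proof.
split; case=> [e|[n [z [? fu fv]]]|[z [m [z' [fu fv tu tv]]]]].
- by constructor 1; rewrite e.
- by constructor 2; exists n, (h + z); split=> //; apply/first_translate.
- constructor 3; exists (h + z), m, (h + z').
  by split; do 1?[exact/first_translate|exact/top_translate].
- by constructor 1; exact: addrI e.
- by constructor 2; exists n, (z - h); split=> //; apply/first_translate; rewrite translateK.
constructor 3; exists (z - h), m, (z' - h).
by split; do 1?[apply/first_translate|apply/top_translate]; rewrite translateK.
Qed.

End Translation.

(** * Regions of the free part *)

Implicit Types (x y : shift_space) (g : Z2).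

Lemma conf_zact g x : conf (zact g x) = translate_conf g (conf x).
Proof.
by apply/funext => n; apply/seteqP; split=> u; rewrite /conf /translate_conf /translate /= zactM.
Qed.

Lemma eqv_conf_zact g x j u v :
  eqv (conf (zact g x)) j u v <-> eqv (conf x) j (g + u) (g + v).
Proof. by rewrite conf_zact; exact: eqv_translate. Qed.

Definition region (k : nat) x : set shift_space :=
  [set zact g x | g in [set g | eqv (conf x) k 0 g]].

Definition regions (k : nat) : set (set shift_space) := [set region k x | x in free_part].

Lemma region_self k x : region k x x.
Proof. by exists 0; [exact: eqv_refl|exact: zact0]. Qed.

Lemma region_zact k x g : free_part x -> region k x (zact g x) -> eqv (conf x) k 0 g.
Proof. by move=> fx [g' eg' /(free_inj fx) <-]. Qed.

Lemma region_eq k x y : region k x y -> region k y = region k x.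
Proof.
move=> [g eg <-]; apply/seteqP; split=> w [h eh <-].
  exists (g + h); last by rewrite zactM.
  move/eqv_conf_zact: eh; rewrite addr0 => eh.
  exact: (eqv_trans (@conf_sparse x) eg eh).
exists (h - g); last by rewrite zactM translateK.
apply/eqv_conf_zact; rewrite addr0 translateK.
exact: (eqv_trans (@conf_sparse x) (eqv_sym eg) eh).
Qed.

Lemma regions_region k A x : regions k A -> A x -> free_part x /\ A = region k x.
Proof.
move=> [w fw <-] rx; split; last by rewrite (region_eq rx).
by case: rx => g _ <-; exact: free_zact.
Qed.

Lemma regions_partition k : partition (regions k) id free_part.
Proof.
split.
- apply/seteqP; split=> x; first by move=> [A PA /(regions_region PA)[]].
  by move=> fx; exists (region k x); [exists x|exact: region_self].
- move=> A B PA PB [x [Ax Bx]].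
  by have [_ ->] := regions_region PA Ax; have [_ ->] := regions_region PB Bx.
by move=> A [x fx <-]; exists x; exact: region_self.
Qed.

Lemma finite_anorm n z (r : nat) : finite_set [set u : Z2 | anorm n (u - z) <= r%:Z].
Proof.
apply: (@sub_finite_set _ _ [set` box (r + absz (l1 z))]); last exact: finite_seq.
move=> u /= h; rewrite mem_box; have := le1_anorm n (u - z); rewrite /l1 /=; lia.
Qed.

Lemma region_finite k x : free_part x -> finite_set (region k x).
Proof.
move=> fx; apply: finite_image; have [n [z H]] := eqv_bounded (@conf_sparse x) (conf_covering fx) k 0.
have : finite_set ([set (0 : Z2)] `|`
    [set u : Z2 | anorm n (u - z) <= (radius n k + growth n)%N%:Z]).
  by rewrite finite_setU; split; [exact: finite_set1|exact: finite_anorm].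
by apply: sub_finite_set => g /H.
Qed.

(** The equation between [y] and a translate of [x] is spelled out coordinatewise, the form used to
    prove it Borel. *)
Lemma same_piece_regions k x y : same_piece (regions k) x y <->
  free_part x /\ exists g, (forall h, y h = x (g + h)) /\ eqv (conf x) k 0 g.
Proof.
split=> [[A PA [Ax Ay]]|[fx [g [yg eg]]]].
  have [fx AE] := regions_region PA Ax; split=> //.
  by move: Ay; rewrite AE => -[g eg <-]; exists g.
have -> : y = zact g x by apply/funext => h; rewrite yg.
exists (region k x); first by exists x.
by split; [exact: region_self|exists g].
Qed.

Lemma regions_borel k : borel_region_partition (regions k).
Proof.
split; first exact: regions_partition.
  move=> A [x fx <-]; split; first exact: region_finite.
  by exists x => // y [g _ <-]; exists g.
have c1 : coordinatewise (fun p : shift_space * shift_space => p.1).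
  by apply: coordinatewise_continuous => p; exact: cvg_fst.
have c2 : coordinatewise (fun p : shift_space * shift_space => p.2).
  by apply: coordinatewise_continuous => p; exact: cvg_snd.
apply: (@bpred_iff _ (fun p : shift_space * shift_space => free_part p.1 /\
  exists g : Z2, (forall h : Z2, exists b, p.2 h = b /\ p.1 (g + h) = b) /\
    eqv (conf p.1) k 0 g)).
  move=> p; rewrite same_piece_regions; split=> -[fx [g [H eg]]]; split=> //; exists g; split=> // h.
    by have [b [-> ->]] := H h.
  by exists (p.2 h); rewrite H.
apply: bpred_and; first exact: bpred_free c1.
apply: bpred_ex => g; apply: bpred_and; last exact: (bpred_eqv _ _ _ c1).
apply: bpred_all => h; apply: bpred_ex => b.
by apply: bpred_and; [exact: c2|exact: c1].
Qed.

(** * Boundaries, orthogonality and atoms *)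

Lemma std_gens_l1 g : g \in std_gens -> l1 g = 1.
Proof. by rewrite !inE => /or4P[] /eqP ->. Qed.

Lemma bdry_edge_point k g x : free_part x -> bdry regions k (zact g x) ->
  edge_point (conf x) k g.
Proof.
move=> fx [A PA [Ax [s sg nAs]]]; have [_ AE] := regions_region PA Ax.
exists (g + s); first by rewrite -[X in X - _]addr0 sub_translate l1C subr0 std_gens_l1.
move=> e; apply: nAs; rewrite AE; exists s => //.
by apply/eqv_conf_zact; rewrite addr0.
Qed.

Lemma bdry_free k x : bdry regions k x -> free_part x.
Proof. by move=> [A PA [/(regions_region PA)[]]]. Qed.

Lemma bdry_no_triple l k1 k2 k3 g1 g3 x : (l <= k1)%N -> (k1 < k2)%N -> (k2 < k3)%N ->
  l1 g1 <= (2 ^ l)%N%:Z -> l1 g3 <= (2 ^ l)%N%:Z -> bdry regions k1 (zact g1 x) ->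
  bdry regions k2 x -> bdry regions k3 (zact g3 x) -> False.
Proof.
move=> lk k12 k23 d1 d3 b1 b2 b3; have fx := bdry_free b2.
have e1 := bdry_edge_point fx b1; have e3 := bdry_edge_point fx b3.
have e2 : edge_point (conf x) k2 0 by apply: bdry_edge_point => //; rewrite zact0.
apply: (no_triple (@conf_sparse x) (conf_covering fx) lk _ _ _ _ _ _ _ e1 e2 e3).
- exact: leq_trans lk (ltnW k12).
- exact: leq_trans lk (ltnW (ltn_trans k12 k23)).
- by rewrite ltn_eqF.
- by rewrite ltn_eqF.
- by rewrite ltn_eqF // (ltn_trans k12).
- by rewrite subr0.
by rewrite l1C subr0.
Qed.

Lemma schreier_path x p : path schreier x p ->
  exists2 g, last x p = zact g x & l1 g <= (size p)%:Z.
Proof.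
elim: p x => [|y p IH] x /=; first by exists 0; rewrite ?zact0.
move=> /andP[/asboolP[s /std_gens_l1 ls ->] /IH[g -> lg]].
exists (s + g); first by rewrite zactM.
by move: ls lg; rewrite /l1 /=; lia.
Qed.

Lemma rho_near (R : realType) (l : nat) x y : (1 <= l)%N ->
  ~ ((((1 / 2 : R) * (2 ^ l)%N%:R)%:E < rho R x y)%E) ->
  exists2 g, y = zact g x & l1 g <= (2 ^ l)%N%:Z.
Proof.
case: l => // l _ /negP; rewrite -leNgt => h.
(* A strict bound on the infimum provides an actual path; lengths being integers, the added 1 is
   lost again. *)
have : (rho R x y < ((1 / 2 : R) * (2 ^ l.+1)%N%:R + 1)%:E)%E.
  by apply: le_lt_trans h _; rewrite lte_fin ltrDl.
move=> /ereal_inf_lt[_ [p [/schreier_path[g lg gp] <-] <-]]; rewrite lte_fin => sp.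
exists g; first by rewrite -lg.
apply: le_trans gp _; rewrite lez_nat.
have : (size p)%:R < (2 ^ l + 1)%N%:R :> R.
  by apply: lt_le_trans sp _; rewrite expnS natrM natrD mulrA; lra.
rewrite ltr_nat addn1 ltnS expnS => /leq_trans; apply.
by rewrite leq_pmull.
Qed.

(** For a boundary point, the bit tells whether a boundary of a level in [[l, k)] passes within
    [2 ^ l]. If [x] and [x'] were close, the bit of [x'] would be 1 because of [x]; equal bits then
    give a third boundary near [x], against [bdry_no_triple]. *)
Lemma regions_orthogonal (R : realType) :
  strongly_orthogonal regions (1 / 2 : R) (fun l => 2 ^ l)%N.
Proof.
exists (fun x k l => `[< (bdry_from regions k x /\ (l <= k)%N) /\
   exists m g, [/\ (l <= m)%N, (m < k)%N, bdry regions m (zact g x) &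
     l1 g <= (2 ^ l)%N%:Z] >]); split.
  by move=> x k l _ _ _ nb; apply/asboolP => -[].
move=> x x' k k' l k1 l1' kk' bx bx' lk e; apply: contrapT => /(rho_near l1')[g xg lg].
have d' : `[< (bdry_from regions k' x' /\ (l <= k')%N) /\
   exists m g, [/\ (l <= m)%N, (m < k')%N, bdry regions m (zact g x') &
     l1 g <= (2 ^ l)%N%:Z] >].
  apply/asboolP; split.
    by split; [exists k'; rewrite /=|exact: leq_trans lk (ltnW kk')].
  exists k, (- g); split=> //; first by rewrite xg zactM subrr zact0.
  by have := l1C 0 g; rewrite sub0r subr0 => ->.
move: e; rewrite d' => /asboolP[_ [m [g' [lm mk bm lg']]]].
by apply: (bdry_no_triple lm mk kk' lg' lg bm bx); rewrite -xg.
Qed.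

(** A path can leave a region of level [k] only from a boundary point of level [k]. *)
Lemma component_region k x y : free_part x -> ~ bdry_from regions k x ->
  component (free_part `\` bdry_from regions k) x y -> region k x y.
Proof.
move=> fx nx [p [pp <- pS]].
suff H w : region k x w -> path schreier w p ->
    {in w :: p, forall z, (free_part `\` bdry_from regions k) z} -> region k x (last w p).
  by apply: H => //; exact: region_self.
elim: p w {pp pS} => [//|z p IH] w rw /= /andP[/asboolP[s sg zs] pp] S.
apply: IH => //; last by move=> v vp; apply: S; rewrite inE vp orbT.
apply: contrapT => nz; have [_] := S w (mem_head _ _); apply.
exists k; first exact: leqnn.
exists (region k x); first by exists x.
by split=> //; exists s => //; rewrite -zs.
Qed.

Lemma regions_decomposition (R : realType) : orthogonal_decomposition regions R.
Proof.
split=> [k _|]; first exact: regions_borel.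
exists (3 / 2), (1 / 2), (fun l => 2 ^ l)%N; split.
- by split; lra.
- move=> k _; split; first by rewrite expn_gt0.
    by rewrite ltn_exp2l.
  rewrite expnS natrM; have : (0 : R) < (2 ^ k)%N%:R by rewrite ltr0n expn_gt0.
  lra.
- apply/seteqP; split=> // x bx.
  (* A point in all the tails lies on boundaries of three distinct levels, which is impossible
     already at distance 0. *)
  have [k1 /= k10 b1] := bx 1%N (leqnn 1).
  have [k2 /= k12 b2] := bx k1.+1 isT.
  have [k3 /= k23 b3] := bx k2.+1 isT.
  by apply: (@bdry_no_triple 0 k1 k2 k3 0 0 x) => //; rewrite zact0.
- move=> k _ x [fx nx]; apply: sub_finite_set (region_finite k fx) => y.
  exact: component_region.
exact: regions_orthogonal.
Qed.

(** By [atom_shape] the atom is a single cell or a piece in orbit coordinates, and both are bounded,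
    connected and convex. *)
Lemma atom_disk (R : realType) k A : atoms regions k A -> homeomorphic_to_disk R A.
Proof.
move=> [[x Ax] [B PB AE]].
have Bx m : (k <= m)%N -> free_part x /\ B m = region m x.
  by move=> km; apply: regions_region (PB _ km) _; move: Ax; rewrite AE; exact.
have [fx _] := Bx k (leqnn k).
have AS : [set g | A (zact g x)] = [set g | forall m, (k <= m)%N -> eqv (conf x) m 0 g].
  apply/seteqP; split=> g; rewrite /= AE => H m km.
    by apply: region_zact => //; have [_ <-] := Bx m km; exact: H.
  by have [_ ->] := Bx m km; exists g => //; exact: H.
exists x; split=> //.
  move=> y; rewrite AE => /(_ k (leqnn k)); have [_ ->] := Bx k (leqnn k).
  by case=> g _ <-; exists g.
rewrite /realization AS.
have [n [kn [single|[m [z [mk cz p0 sub sup]]]]]] :=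
  atom_shape (@conf_sparse x) (conf_covering fx) k 0.
  apply: (@cells_disk R 0 _ 0).
  - by exists 0 => m _; exact: eqv_refl.
  - by move=> u /(_ n kn) /single ->.
  - by move=> u v /(_ n kn) /single -> /(_ n kn) /single ->; exact: linked_refl.
  move=> u [p [q [/(_ n kn) /single -> /(_ n kn) /single ->]]].
  rewrite /cone_le /= expn0 => h1 h2 m _.
  have -> : u = 0; last exact: eqv_refl.
  by rewrite (surjective_pairing u); congr pair; lia.
have -> : [set g | forall m, (k <= m)%N -> eqv (conf x) m 0 g] = piece (conf x) m m z.
  apply/seteqP; split=> g; first by move=> /(_ n kn) /sub.
  by move=> pg j kj; exact: sup.
apply: (@cells_disk R 0 _ (radius m m + growth m + absz (l1 z))).
- by exists 0.
- move=> u /piece_radius h; have := le1_anorm m (u - z); move: h; rewrite /l1 /=; lia.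
- exact: piece_connected.
exact: piece_convex.
Qed.

Theorem corollary5p8 (R : realType) :
  exists P : nat -> set (set shift_space),
    orthogonal_decomposition P R /\
    forall k : nat, (1 <= k)%N ->
      forall A : set shift_space, atoms P k A -> homeomorphic_to_disk R A.
Proof.
exists regions; split; first exact: regions_decomposition.
by move=> k _ A; exact: atom_disk.
Qed.
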